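(* Let $X$ be a compact metric space, let $f:X\to X$ be continuous, and fix a distance $\mathsf d\in\{\mathsf W_p:1\le p<\infty\}\cup\{\mathsf{LP}\}$ on $\mathcal M(X)$. For every $f$-invariant $\mu\in\mathcal M(X)$, with ergodic decomposition $\hat\mu=\mathbf e^f_*\mu\in\mathcal M(\mathcal M(X))$, and every $\epsilon>0$, $$\mathscr E_\mu(f)(\epsilon)=Q_{\hat\mu}(\epsilon),$$ where $Q_{\hat\mu}$ is the quantization number of $\hat\mu$ for the metric $\mathsf W_1$ on $\mathcal M(\mathcal M(X))$ induced by the distance $\mathsf d$ on $\mathcal M(X)$.
   Context: For a compact metric space $(Y,\mathsf d)$, $\mathcal M(Y)$ is the set of Borel probability measures on $Y$. For $p\ge1$, $\mathsf W_p(\mu,\nu)=\inf_\pi\left(\int_{Y\times Y}\mathsf d(x,y)^p\,d\pi(x,y)\right)^{1/p}$, the infimum over all probability measures $\pi$ on $Y\times Y$ with marginals $\mu,\nu$. $\mathsf{LP}(\mu,\nu)$ (Lévy–Prokhorov) is the infimum of $\epsilon>0$ such that for every Borel $E\subset Y$, $\nu(E)\le\mu(V_\epsilon(E))+\epsilon$ and $\mu(E)\le\nu(V_\epsilon(E))+\epsilon$, where $V_\epsilon(E)$ is the $\epsilon$-neighborhood of $E$. With any of these distances $\mathcal M(Y)$ is a compact metric space carrying the weak topology. The quantization number $Q_\mu(\epsilon)$ of $\mu\in\mathcal M(Y)$ (with respect to a given distance on $\mathcal M(Y)$) is the least integer $N$ such that there is a probability measure $\nu$ on $Y$ at distance $\le\epsilon$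 from $\mu$ and supported on a set of cardinality $N$. For $f$-invariant $\mu$, $\mathbf e^f(x)=\lim_n\frac1n\sum_{i=0}^{n-1}\delta_{f^i(x)}$ (weak limit) exists for $\mu$-a.e. $x$; $\mathbf e^f_*\mu$ is the push-forward of $\mu$ under $x\mapsto\mathbf e^f(x)$. The metric emergence $\mathscr E_\mu(f)(\epsilon)$ is the minimal $N$ for which there exist $\mu_1,\dots,\mu_N\in\mathcal M(X)$ with $\int\min_{1\le i\le N}\mathsf d(\mathbf e^f(x),\mu_i)\,d\mu(x)\le\epsilon$. *)

(* Defs.v *)
From HB Require Import structures.
From mathcomp Require Import all_boot all_order all_algebra.
From mathcomp Require Import all_classical all_reals all_analysis.

Set Implicit Arguments.
Unset Strict Implicit.
Unset Printing Implicit Defensive.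

Import Order.TTheory GRing.Theory Num.Theory.
Import numFieldNormedType.Exports.

Local Open Scope classical_set_scope.
Local Open Scope ring_scope.

(* Generated sigma-algebras in the library live on pointed types. A space
   carrying a probability measure is nonempty, so no generality is lost. *)
#[short(type="pmetricType")]
HB.structure Definition PointedMetric (K : numDomainType) :=
  {M of Metric K M & Pointed M}.

Definition borel (Y : ptopologicalType) := g_sigma_algebraType (@open Y).

(* A library [probability] is a function on all subsets, constrained only on
   the measurable ones. Setting it to 0 off the Borel sets makes two of these
   equal iff they agree on Borel sets, so that the type below is the set of
   Borel probability measures and its weak topology can be Hausdorff. *)
Record borel_probability (R : realType) (Y : ptopologicalType) :=
  BorelProbability {
    bp_val :> probability (borel Y) R ;
    bp_canonical : forall A : set (borel Y), ~ measurable A -> bp_val A = 0%E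
  }.

Lemma borel_probability_ext (R : realType) (Y : ptopologicalType)
    (mu nu : borel_probability R Y) :
  (forall A : set (borel Y), measurable A -> mu A = nu A) -> mu = nu.
Proof.
move=> h.
have e : mu = nu :> (set (borel Y) -> \bar R).
  apply/funext => A; have [mA|nA] := pselect (measurable A); first exact: h.
  by rewrite !bp_canonical.
case: mu nu h e => [mu mc] [nu nc] /= _ e.
have e2 : mu = nu.
  case: mu nu e {mc nc} => [mu cm] [nu cn] /= e; subst nu; congr Probability.Pack.
  case: cm cn => [[a1 a2] [a3] [a4] [a5] [a6] [a7] [a8]]
    [[b1 b2] [b3] [b4] [b5] [b6] [b7] [b8]].
  by rewrite (Prop_irrelevance a1 b1) (Prop_irrelevance a2 b2)
    (Prop_irrelevance a3 b3) (Prop_irrelevance a4 b4) (Prop_irrelevance a5 b5)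
    (Prop_irrelevance a6 b6) (Prop_irrelevance a7 b7) (Prop_irrelevance a8 b8).
move: mc nc; rewrite e2 => mc nc; congr BorelProbability.
exact: Prop_irrelevance.
Qed.

Section restriction.
Local Open Scope ereal_scope.
Context (R : realType) (Y : ptopologicalType) (mu : probability (borel Y) R).

Definition borel_restriction (A : set (borel Y)) : \bar R :=
  if `[< measurable A >] then mu A else 0.

Let restriction0 : borel_restriction set0 = 0.
Proof. by rewrite /borel_restriction; case: asboolP. Qed.

Let restriction_ge0 A : 0 <= borel_restriction A.
Proof. by rewrite /borel_restriction; case: asboolP. Qed.

Let restriction_sigma_additive : semi_sigma_additive borel_restriction.
Proof.
move=> F mF tF mUF; rewrite /borel_restriction (asboolT mUF).
under eq_fun do under eq_bigr do rewrite (asboolT (mF _)).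
exact: measure_semi_sigma_additive.
Qed.

HB.instance Definition _ := isMeasure.Build _ _ _ borel_restriction
  restriction0 restriction_ge0 restriction_sigma_additive.

Let restrictionT : borel_restriction setT = 1.
Proof. by rewrite /borel_restriction asboolT// probability_setT. Qed.

HB.instance Definition _ :=
  Measure_isProbability.Build _ _ _ borel_restriction restrictionT.

Lemma borel_restriction_canonical (A : set (borel Y)) :
  ~ measurable A -> borel_restriction A = 0.
Proof. by move=> nA; rewrite /borel_restriction asboolF. Qed.

Definition to_borel : borel_probability R Y :=
  @BorelProbability R Y borel_restriction borel_restriction_canonical.

End restriction.

Section weak_topology.
Context (R : realType) (Y : ptopologicalType).

Definition bounded_continuous :=
  {g : Y -> R^o | continuous g /\ [bounded g y | y in [set: Y]]}.

Definition test_integrals (mu : borel_probability R Y) :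
    {ptws bounded_continuous -> R^o} :=
  fun g => \int[mu]_(y in [set: borel Y]) (sval g y).

HB.instance Definition _ := gen_eqMixin (borel_probability R Y).
HB.instance Definition _ := gen_choiceMixin (borel_probability R Y).
HB.instance Definition _ := isPointed.Build (borel_probability R Y)
  (to_borel (dirac (point : borel Y))).
HB.instance Definition _ := Topological.copy (borel_probability R Y)
  (initial_topology test_integrals).

End weak_topology.

Lemma borel_probability_cvgP (R : realType) (Y : ptopologicalType)
    (u : nat -> borel_probability R Y) (mu : borel_probability R Y) :
  (u n @[n --> \oo] --> mu) <->
  (forall g : bounded_continuous R Y,
    test_integrals (u n) g @[n --> \oo] --> test_integrals mu g).
Proof.
have hc : continuous (@test_integrals R Y : borel_probability R Y -> _) by exact: initial_continuous.
have P : test_integrals (u n) @[n --> \oo] --> test_integrals mu <->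
  (forall g, test_integrals (u n) g @[n --> \oo] --> test_integrals mu g).
  rewrite cvg_sup; split.
    move=> + g => /(_ g); rewrite cvg_image; last first.
      by rewrite eqEsubset; split=> v // _; exists (cst v).
    apply: cvg_trans => W /=; rewrite ?nbhs_simpl /fmap /= => [[W' + <-]].
    by apply: filterS => z W'g /=; exists (test_integrals (u z)).
  move=> + i => /(_ i) h.
  rewrite cvg_image; last first.
      by rewrite eqEsubset; split=> v // _; exists (cst v).
  move=> W /h Q; exists (@^~ i @^-1` W) => //.
  by rewrite eqEsubset; split => [j [? + <-//]|j Wj]; exists (fun _ => j).
split=> [h|/P h2]; first by apply/P; exact: (cvg_comp _ _ h (hc mu)).
move=> A [B [[C oC <-] Cmu] /filterS]; apply.
by apply: h2; exact: open_nbhs_nbhs.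
Qed.

(* Distances are extended-real-valued so that no finiteness proof is needed to
   define them; on a compact space all those below are finite. *)
Section distances.
Local Open Scope ereal_scope.
Context (R : realType) (Y : ptopologicalType) (dist : Y -> Y -> \bar R).
Implicit Types mu nu : borel_probability R Y.

(* On a separable metric space, the product sigma-algebra used here is the
   Borel sigma-algebra of the product. *)
Definition transport_plan mu nu : set (probability (borel Y * borel Y)%type R) :=
  [set pi | forall A : set (borel Y), measurable A ->
    pi (A `*` setT) = mu A /\ pi (setT `*` A) = nu A].

Definition wasserstein (p : R) mu nu : \bar R :=
  ereal_inf [set (\int[pi]_z (dist z.1 z.2 `^ p)) `^ p^-1
            | pi in transport_plan mu nu].

Definition neighborhood (e : R) (E : set Y) : set Y :=
  [set y | exists2 x, E x & dist x y < e%:E].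

Definition levy_prokhorov mu nu : \bar R :=
  ereal_inf [set e%:E | e in [set e : R | (0 < e)%R /\
    forall E : set (borel Y), measurable E ->
      nu E <= mu (neighborhood e E) + e%:E /\
      mu E <= nu (neighborhood e E) + e%:E]].

End distances.

Inductive measure_distance (R : realType) :=
| Wasserstein (p : R) of 1 <= p
| LevyProkhorov.
Arguments LevyProkhorov {R}.

Definition distance_of (R : realType) (D : measure_distance R)
    (Y : ptopologicalType) (dist : Y -> Y -> \bar R) :
    borel_probability R Y -> borel_probability R Y -> \bar R :=
  match D with
  | Wasserstein p _ => wasserstein dist p
  | LevyProkhorov => levy_prokhorov dist
  end.

(* The least N is an infimum in the extended reals: it is attained unless there
   is no admissible N, in which case it is +oo. *)
Definition least (R : realType) (A : set nat) : \bar R :=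
  ereal_inf [set N%:R%:E | N in A].

Definition quantization_number (R : realType) (Y : ptopologicalType)
    (delta : borel_probability R Y -> borel_probability R Y -> \bar R)
    (mu : borel_probability R Y) (eps : R) : \bar R :=
  least R [set N | exists nu : borel_probability R Y,
    (delta mu nu <= eps%:E)%E /\
    exists S : set Y, (S #= `I_N)%card /\ nu S = 1%E].

Section emergence.
Context (R : realType) (X : ptopologicalType) (f : X -> X).

Definition invariant_measure (mu : borel_probability R X) :=
  forall A : set (borel X), measurable A -> mu (f @^-1` A) = mu A.

Section empirical.
Context (x : X) (n : nat).

Definition orbit_average : set (borel X) -> \bar R :=
  mscale (n.+1%:R^-1)%:nng
    (msum (fun i => @dirac _ (borel X) (iter i f x) R) n.+1).

HB.instance Definition _ := Measure.on orbit_average.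

Let orbit_averageT : orbit_average setT = 1%E.
Proof.
rewrite /orbit_average /mscale/= /msum.
rewrite (eq_bigr (fun=> 1%:E)) => [|i _]; last exact: probability_setT.
by rewrite sumEFin -EFinM sumr_const card_ord mulVf.
Qed.

HB.instance Definition _ :=
  Measure_isProbability.Build _ _ _ orbit_average orbit_averageT.

Definition empirical : borel_probability R X := to_borel orbit_average.

End empirical.

(* [lim] is a fixed default measure at the points where the sequence does not
   converge. *)
Definition empirical_limit (x : X) : borel_probability R X :=
  lim (empirical x n @[n --> \oo]).

(* There is at most one measure with the prescribed values on Borel sets, and
   there is one as soon as [g] is Borel measurable. *)
Definition borel_pushforward (Z : ptopologicalType) (g : X -> Z)
    (mu : borel_probability R X) : borel_probability R Z :=
  get [set nu : borel_probability R Z |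
    forall A : set (borel Z), measurable A -> nu A = mu (g @^-1` A)].

Definition ergodic_decomposition (mu : borel_probability R X) :
    borel_probability R (borel_probability R X) :=
  borel_pushforward empirical_limit mu.

Definition metric_emergence
    (delta : borel_probability R X -> borel_probability R X -> \bar R)
    (mu : borel_probability R X) (eps : R) : \bar R :=
  least R [set N | exists nu : 'I_N -> borel_probability R X,
    (\int[mu]_(x in [set: borel X])
       \big[Order.min/+oo]_(i < N) delta (empirical_limit x) (nu i)
     <= eps%:E)%E].

End emergence.

(* Main.v *)
Require Import Defs.
From HB Require Import structures.
From mathcomp Require Import all_boot all_order all_algebra.
From mathcomp Require Import all_classical all_reals all_analysis.
From mathcomp Require Import measurable_realfun ring lra.
Set Implicit Arguments.
Unset Strict Implicit.
Unset Printing Implicit Defensive.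
Import Order.TTheory GRing.Theory Num.Theory.
Import numFieldNormedType.Exports.
Local Open Scope classical_set_scope.
Local Open Scope ring_scope.

(** Write e for the map sending x to the limit of its empirical measures, so that the
    ergodic decomposition of mu is the image of mu by e.  The equality rests on the
    fact that, for the distance W_1, the best way to transport a measure to a given
    finite set is to send each point to a nearest point of that set.

    Given centres nu_1, ..., nu_N, a measurable nearest-centre map T pushes the
    decomposition to a measure supported by the centres, and the plan carried by the
    graph of T costs exactly the integral of the distance from e(x) to the centres
    ([quantization_of_centers]).  Conversely, a plan between the decomposition and a
    measure supported by N points costs at least the average distance to the nearest
    of these points ([centers_of_quantization]).  Integrals of nonnegative functions
    are lower integrals, so that these two estimates need no measurability of the
    distance on the product space.

    What they do need is that e is Borel measurable, that points are Borel in the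
    space of measures ([measurable_singleton]), and that the distance to a fixed
    measure is a Borel function.  For e and for W_p this uses one principle
    ([measurable_separated]): a set which is open for the topology induced by
    countably many measurable real functions is measurable.

    For e, these functions are the integrals of countably many partitions of unity,
    which determine the weak topology because they approximate the integral of any
    continuous function ([mean_near], [open_pou]).  The set where the empirical
    measures converge is that where these integrals converge ([cvg_measuresP]): a
    limit of the integrals of all continuous functions is a positive functional,
    hence a measure ([riesz_representation], through the outer measure of open sets
    and the Caratheodory criterion).

    For the Levy-Prokhorov distance, sublevel sets are weakly open, because the mass
    of an open set is lower semicontinuous and finitely many unions of small balls
    suffice to test all Borel sets ([open_levy_prokhorov_lt]).  For W_p, the
    functions are the masses of the cells of finite partitions into small cells: when
    mu' gives each cell almost the mass that mu gives to it, a plan starting at mu is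
    modified into one starting at mu' of almost the same cost ([transfer_plan],
    [wasserstein_lt_cells]). *)

(** * Lower integrals *)

Section lower_integral.
Local Open Scope ereal_scope.
Import HBNNSimple.

(** The integral of a nonnegative function is by definition a supremum over the
    simple functions below it, hence a lower integral when the function is not
    measurable.  Working with it directly avoids any question about the
    measurability of a cost on a product space. *)
Lemma le_lower_integral d (T : measurableType d) (R : realType)
    (mu : {measure set T -> \bar R}) (f g : T -> \bar R) :
  (forall x, 0 <= f x) -> (forall x, f x <= g x) ->
  \int[mu]_x f x <= \int[mu]_x g x.
Proof.
move=> f0 fg; have g0 x : 0 <= g x := le_trans (f0 x) (fg x).
rewrite !ge0_integralTE//; apply: ereal_sup_le => _ [h hf <-].
by exists h => // x; exact: le_trans (hf x) (fg x).
Qed.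

Lemma lower_integral_pushforward d d' (T : measurableType d)
    (U : measurableType d') (R : realType) (mu : {measure set T -> \bar R})
    (nu : {measure set U -> \bar R}) (phi : T -> U) (f : U -> \bar R) :
  measurable_fun [set: T] phi ->
  (forall A, measurable A -> nu A = mu (phi @^-1` A)) ->
  (forall y, 0 <= f y) -> \int[nu]_y f y <= \int[mu]_x f (phi x).
Proof.
move=> mphi nuE f0; rewrite [leLHS]ge0_integralTE//.
apply: ge_ereal_sup => _ [h hf <-].
have -> : sintegral nu h = \int[nu]_y (h y)%:E.
  by rewrite integral_nnsfun// patch_setT.
rewrite (eq_measure_integral (pushforward mu phi)); last first.
  by move=> A mA _; rewrite nuE.
rewrite ge0_integral_pushforward//; last 2 first.
- exact/measurable_EFinP.
- by move=> y _; rewrite lee_fin.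
by apply: le_lower_integral => x /=; rewrite ?lee_fin// hf.
Qed.

Lemma measurable_integral_pushforward d d' (T : measurableType d)
    (U : measurableType d') (R : realType) (mu : {measure set T -> \bar R})
    (nu : {measure set U -> \bar R}) (phi : T -> U) (f : U -> \bar R) :
  measurable_fun [set: T] phi ->
  (forall A, measurable A -> nu A = mu (phi @^-1` A)) ->
  measurable_fun [set: U] f ->
  (forall y, 0 <= f y) -> \int[nu]_y f y = \int[mu]_x f (phi x).
Proof.
move=> mphi nuE mf f0.
rewrite (eq_measure_integral (pushforward mu phi)); last first.
  by move=> A mA _; rewrite nuE.
by rewrite ge0_integral_pushforward// preimage_setT.
Qed.

End lower_integral.

(** * From nearest points to optimal quantizations *)

Section probability_of_measure.
Local Open Scope ereal_scope.
Context d (T : measurableType d) (R : realType).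
Variables (m : {measure set T -> \bar R}) (m1 : m setT = 1).

Let m' of m setT = 1 := (m : set T -> \bar R).

HB.instance Definition _ := Measure.copy (m' m1) m.

HB.instance Definition _ := Measure_isProbability.Build _ _ _ (m' m1) m1.

Lemma probability_of_measure :
  exists P : probability T R, forall A, P A = m A.
Proof. by exists (m' m1). Qed.

End probability_of_measure.

Section pushforward.
Context (R : realType).

Lemma to_borelE (Y : ptopologicalType) (P : probability (borel Y) R)
  (A : set (borel Y)) : measurable A -> to_borel P A = P A.
Proof. by move=> mA; rewrite /= /borel_restriction asboolT. Qed.

Lemma probability_pushforward d d' (T : measurableType d)
    (U : measurableType d') (mu : probability T R) (phi : T -> U) :
  measurable_fun [set: T] phi ->
  exists P : probability U R, forall A, P A = mu (phi @^-1` A).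
Proof.
move=> mphi.
pose X := mfun_Sub (mem_set mphi : phi \in mfun).
by exists (distribution mu X).
Qed.

(** Measurability of g is what makes the pushforward more than a default value. *)
Lemma borel_pushforwardE (X Z : ptopologicalType) (g : X -> Z)
    (mu : borel_probability R X) :
  measurable_fun [set: borel X] (g : borel X -> borel Z) ->
  forall A : set (borel Z), measurable A ->
    borel_pushforward g mu A = mu (g @^-1` A).
Proof.
move=> mg.
suff : [set nu : borel_probability R Z | forall A : set (borel Z),
    measurable A -> nu A = mu (g @^-1` A)] !=set0 by move=> /getPex.
have [P PE] := probability_pushforward mu mg.
by exists (to_borel P) => A mA; rewrite to_borelE.
Qed.

End pushforward.

Section nearest_point.
Local Open Scope ereal_scope.
Context (R : realType) (X : ptopologicalType).
Local Notation M := (borel_probability R X).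
Context (delta : M -> M -> \bar R).
Hypothesis mdelta : forall nu, measurable_fun [set: borel M]
  ((fun y => delta y nu) : borel M -> \bar R).

(** A measurable nearest-point projection onto a finite family; ties are broken
    by the order of the list. *)
Lemma nearest_point (s : seq M) : s != [::] ->
  exists T : borel M -> borel M,
    [/\ measurable_fun setT T, forall y, T y \in s,
        forall y a, a \in s -> delta y (T y) <= delta y a &
        measurable_fun setT (fun y : borel M => delta y (T y))].
Proof.
elim: s => // a [_ _|b s IH _].
  exists (cst a); split=> [|y|y c|]; first exact: measurable_cst.
 
  - by rewrite mem_seq1.
  - by rewrite mem_seq1 => /eqP ->.
  - exact: mdelta.
have [//|T [mT Ts Tmin mdT]] := IH.
pose le y := delta y a <= delta y (T y).
exists (fun y => if le y then a else T y); split.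
- by apply: measurable_fun_ifT => //; exact: measurable_fun_lee.
- by move=> y; case: ifPn => _; rewrite in_cons ?eqxx// Ts orbT.
- move=> y c; rewrite in_cons => /predU1P[->|cs]; case: ifPn => //.
  + by rewrite /le -ltNge => /ltW.
  + by move=> /le_trans; apply; exact: Tmin.
  + by move=> _; exact: Tmin.
- rewrite (_ : (fun y => _) =
      fun y => if le y then delta y a else delta y (T y)).
    by apply: measurable_fun_ifT => //; exact: measurable_fun_lee.
  by apply/funext => y; case: ifP.
Qed.

End nearest_point.

Section emergence_quantization.
Local Open Scope ereal_scope.
Context (R : realType) (X : ptopologicalType) (f : X -> X).
Local Notation M := (borel_probability R X).
Context (delta : M -> M -> \bar R) (mu : borel_probability R X) (eps : R).
Hypothesis delta_ge0 : forall nu nu', 0 <= delta nu nu'.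
Hypothesis mdelta : forall nu, measurable_fun [set: borel M]
  ((fun y => delta y nu) : borel M -> \bar R).
Hypothesis measurable_point : forall nu : M, measurable ([set nu] : set (borel M)).
Hypothesis me : measurable_fun [set: borel X]
  (empirical_limit R f : borel X -> borel M).

Local Notation e := (empirical_limit R f).
Local Notation muhat := (ergodic_decomposition f mu).

Let muhatE (A : set (borel M)) : measurable A -> muhat A = mu (e @^-1` A).
Proof. exact: borel_pushforwardE. Qed.

Lemma wasserstein1E (Y : ptopologicalType) (dist : Y -> Y -> \bar R)
    (m1 m2 : borel_probability R Y) : (forall x y, 0 <= dist x y) ->
  wasserstein dist 1 m1 m2 =
    ereal_inf [set \int[pi]_z dist z.1 z.2 | pi in transport_plan m1 m2].
Proof.
move=> dist0; congr ereal_inf; apply: eq_imagel => pi _.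
rewrite invr1 poweRe1; last by apply: integral_ge0 => z _; exact: poweR_ge0.
by apply: eq_integral => z _; rewrite poweRe1.
Qed.

Let min_dist n (nu : 'I_n -> M) (y : M) :=
  \big[Order.min/+oo]_(i < n) delta y (nu i).

Let min_dist_ge0 n (nu : 'I_n -> M) y : 0 <= min_dist nu y.
Proof. by apply: le_bigmin => // i _; exact: leey. Qed.

(** Sending each point to a nearest centre quantizes the ergodic decomposition
    with transport cost the average distance to the centres; as centres may
    coincide, the support has at most n points. *)
Lemma quantization_of_centers n (nu : 'I_n -> M) :
  \int[mu]_x min_dist nu (e x) <= eps%:E ->
  exists2 k, (k <= n)%N & exists nuhat : borel_probability R M,
    wasserstein delta 1 muhat nuhat <= eps%:E /\
    exists S : set M, (S #= `I_k)%card /\ nuhat S = 1.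
Proof.
move=> cost_le.
(* With no centre the minimum is +oo, and its integral is not at most eps. *)
have [n0|n_gt0] := posnP n.
  move: cost_le; rewrite /min_dist; subst n; under eq_integral do rewrite big_ord0.
  rewrite integral_cst// [X in _ * X](_ : _ = 1) ?mule1 ?leye_eq//.
  exact: (probability_setT (bp_val mu)).
have s0 : codom nu != [::].
  by rewrite -size_eq0 size_codom card_ord -lt0n.
have [T [mT Ts Tmin mdT]] := nearest_point mdelta s0.
have [P PE] := probability_pushforward muhat mT.
have mS : measurable (range nu : set (borel M)).
  rewrite (_ : range nu = \bigcup_i [set nu i]); last first.
    by apply/seteqP; split => [_ [i _ <-]|_ [i _ ->]]; exists i.
  by apply: fin_bigcup_measurable.
have [k Sk] : finite_set (range nu) by exact: finite_image.
exists k.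
  have /card_eqPle[_ kS] := Sk; have /card_eqPle[_ nT] := @card_II n.
  rewrite -card_le_II; apply: card_le_trans kS _; apply: card_le_trans nT.
  exact: card_image_le.
have to_P A : measurable A -> to_borel P A = muhat (T @^-1` A).
  by move=> mA; rewrite to_borelE.
exists (to_borel P); split; last first.
  exists (range nu); split => //.
  rewrite to_P// (_ : T @^-1` _ = setT) ?probability_setT//.
  by apply/seteqP; split=> // y _ /=; have /codomP[i ->] := Ts y; exists i.
pose graph (y : borel M) : (borel M * borel M)%type := (y, T y).
have mgraph : measurable_fun [set: borel M] graph.
  by apply: measurable_fun_pair.
have [pi piE] : exists pi : probability (borel M * borel M)%type R,
    forall A, pi A = muhat (graph @^-1` A).
  exact: probability_pushforward.
rewrite wasserstein1E//; apply: (@le_trans _ _ (\int[pi]_z delta z.1 z.2)).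
  apply: ereal_inf_lbound; exists pi => // A mA; split.
    by rewrite piE; congr (muhat _); apply/seteqP; split=> y //= -[].
  rewrite piE to_P//; congr (muhat _).
  by apply/seteqP; split=> y //= -[].
apply: (@le_trans _ _ (\int[muhat]_y delta y (T y))).
  refine (@lower_integral_pushforward _ _ _ _ _ muhat pi graph
    (fun z => delta z.1 z.2) mgraph _ _) => //.
  by move=> A _; exact: piE.
apply: (@le_trans _ _ (\int[mu]_x delta (e x) (T (e x)))).
  refine (@lower_integral_pushforward _ _ _ _ _ mu muhat _
    (fun y => delta y (T y)) me _ _) => //.
apply: le_trans cost_le; apply: le_lower_integral => // x.
apply: le_bigmin => [|i _]; first exact: leey.
by apply: Tmin; exact: codom_f.
Qed.

(** Every point of the support being one of the centres, any transport plan costs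
    at least the average distance to the nearest centre. *)
Lemma centers_of_quantization n (nuhat : borel_probability R M) (S : set M) :
  wasserstein delta 1 muhat nuhat <= eps%:E -> (S #= `I_n)%card ->
  nuhat S = 1 ->
  exists nu : 'I_n -> M, \int[mu]_x min_dist nu (e x) <= eps%:E.
Proof.
move=> W_le /card_esym/pcard_eqP[g] nuS.
have mS : measurable (S : set (borel M)).
  have [//|nmS] := pselect (measurable (S : set (borel M))).
  by move/eqP: nuS; rewrite bp_canonical// eq_sym onee_eq0.
pose nu (i : 'I_n) := g i; exists nu.
have n0 : codom nu != [::].
  rewrite -size_eq0 size_codom card_ord; apply/eqP => n0.
  have S0 : S = set0.
    rewrite -(image_eq g) -subset0 => _ [i /= + _]; by rewrite n0.
  by move/eqP: nuS; rewrite S0 measure0 eq_sym onee_eq0.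
have Snu y : S y -> y \in codom nu.
  rewrite -(image_eq g) => -[i /= i_lt <-].
  by rewrite -[i]/(val (Ordinal i_lt)); exact: codom_f.
have [T [mT Ts Tmin mdT]] := nearest_point mdelta n0.
have min_le y : min_dist nu y <= delta y (T y).
  by have /codomP[i ->] := Ts y; exact: bigmin_le.
apply/lee_addgt0Pr => r r0.
have : wasserstein delta 1 muhat nuhat < (eps + r)%:E.
  by rewrite (le_lt_trans W_le)// lte_fin ltrDl.
rewrite wasserstein1E// => /ereal_inf_lt[_ [pi piP <-]] /ltW.
apply: le_trans.
apply: (@le_trans _ _ (\int[mu]_x delta (e x) (T (e x)))).
  by apply: le_lower_integral.
rewrite -(measurable_integral_pushforward (nu := muhat)
  (f := fun y => delta y (T y)) me)//.
rewrite (measurable_integral_pushforward (mu := pi) (phi := fst)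
  (f := fun y : borel M => delta y (T y)))//; last first.
  move=> A mA; apply: eq_trans (esym (piP A mA).1) _.
  by congr (pi _); apply/seteqP; split=> z //= -[].
have mN : measurable ([set: borel M] `*` ~` S : set (borel M * borel M)).
  by apply: measurableX => //; exact: measurableC.
rewrite (ge0_negligible_integral mN)//; last 2 first.
- exact: (measurableT_comp mdT measurable_fst).
- apply: eq_trans (piP _ (measurableC mS)).2 _.
  by apply: eq_trans (probability_setC _ mS) _; rewrite nuS subee.
rewrite integral_mkcond; apply: le_lower_integral => z.
  by apply: erestrict_ge0.
rewrite patchE; case: ifPn => // /[!inE]/= -[_ zN].
apply: Tmin; apply: Snu; apply: contrapT => zS; exact: zN.
Qed.

End emergence_quantization.

(** * Measurability through countably many real functions *)

Section measurable_separated.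
Context d (T : measurableType d) (R : realType) (I : countType) (h : I -> T -> R).
Hypothesis mh : forall i, measurable_fun setT (h i).

Let box (b : seq (I * rat)) (j : nat) : set T :=
  [set y | all (fun p => `|h p.1 y - ratr p.2| < j.+1%:R^-1) b].

Let measurable_box b j : measurable (box b j).
Proof.
elim: b => [|[i q] b IH].
  by rewrite (_ : box _ _ = setT)//; apply/seteqP; split.
rewrite (_ : box _ _ =
    [set y | `|h i y - ratr q| < j.+1%:R^-1] `&` box b j); last first.
  by apply/seteqP; split=> y /= => [/andP[]//|[? ?]]; exact/andP.
apply: measurableI => //.
have mf : measurable_fun setT (fun y => `|h i y - ratr q| < j.+1%:R^-1).
  apply: measurable_fun_ltr => //.
  by apply: measurableT_comp => //; exact: measurable_funB.
rewrite -[X in measurable X]setTI.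
exact: (mf measurableT [set true]).
Qed.

(** A set which is open for the topology induced by countably many measurable
    functions is a countable union of rational boxes. *)
Lemma measurable_separated (S : set T) :
  (forall y, S y -> exists s : seq I, exists2 eta : R, 0 < eta &
    forall y', (forall i, i \in s -> `|h i y' - h i y| < eta) -> S y') ->
  measurable S.
Proof.
move=> openS.
pose good (p : seq (I * rat) * nat) := box p.1 p.2 `<=` S.
rewrite (_ : S = \bigcup_p (if `[< good p >] then box p.1 p.2 else set0)).
  by apply: countable_bigcupT_measurable => // p; case: ifP.
apply/seteqP; split=> y; last by move=> [p _]; case: ifPn => // /asboolP; apply.
move=> /openS[s [eta eta0 Sy]].
pose j := Num.trunc (2 / eta).
have j_lt : j.+1%:R^-1 + j.+1%:R^-1 < eta :> R.
  rewrite -mulr2n -[ltLHS]mulr_natr -ltr_pdivlMr// -[X in _ < X]invrK.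
  rewrite ltf_pV2 ?posrE ?invr_gt0 ?divr_gt0// invf_div.
  exact: truncnS_gt.
have rat_near i : {q : rat | `|h i y - ratr q| < j.+1%:R^-1}.
  apply: cid; have : h i y - j.+1%:R^-1 < h i y + j.+1%:R^-1.
    by rewrite ltrD2l gtrN// invr_gt0.
  move=> /rat_in_itvoo[q]; rewrite in_itv/= => /andP[q1 q2]; exists q.
  by rewrite distrC ltr_distl q1.
pose b := [seq (i, sval (rat_near i)) | i <- s].
exists (b, j) => //; have goodb : good (b, j).
  move=> y' /allP boxy; apply: Sy => i si.
  have := boxy (i, sval (rat_near i)); rewrite map_f// => /(_ isT)/= y'q.
  rewrite (le_lt_trans (ler_distD (ratr (sval (rat_near i))) _ _))//.
  apply: lt_trans j_lt; rewrite ltrD// distrC.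
  exact: (svalP (rat_near i)).
rewrite (asboolT goodb); apply/allP => _ /mapP[i _ ->] /=.
exact: (svalP (rat_near i)).
Qed.

End measurable_separated.

(** * Continuous functions on a compact metric space *)

Lemma continuous_measurable_borel (R : realType) (Y : ptopologicalType)
    (g : Y -> R^o) :
  continuous g -> measurable_fun [set: borel Y] (g : borel Y -> R).
Proof.
move=> cg; apply: (measurability _ (RGenOInfty.measurableE R)).
move=> _ [_ [a ->] <-]; rewrite setTI; apply: sub_sigma_algebra.
have /continuousP := cg; apply.
by rewrite set_itvE; exact: open_gt.
Qed.

Section metric.
Context (R : realType) (X : pmetricType R).
Implicit Types (g : X -> R^o) (A : set X).

Lemma continuous_mdistP g : continuous g <-> forall x e, 0 < e ->
  exists2 d, 0 < d & forall y, mdist x y < d -> `|g x - g y| < e.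
Proof.
split=> [cg x e e0|h x].
  have /cvgrPdist_lt/(_ e e0)/nbhs_ballP[d d0 hd] := cg x.
  by exists d => // y xy; apply: hd; rewrite ballEmdist.
apply/cvgrPdist_lt => e e0; have [d d0 hd] := h x e e0.
by apply/nbhs_ballP; exists d => // y; rewrite ballEmdist; exact: hd.
Qed.

Lemma lipschitz_continuous g :
  (forall x y, `|g x - g y| <= mdist x y) -> continuous g.
Proof.
move=> lg; apply/continuous_mdistP => x e e0; exists e => // y.
exact: le_lt_trans.
Qed.

Lemma mdist_continuous (c : X) : continuous (mdist c : X -> R^o).
Proof.
apply: lipschitz_continuous => x y; rewrite ler_distl lerBlDr.
by rewrite metric_triangle/= [mdist x y]metric_sym metric_triangle.
Qed.

Lemma open_mdistP A : open A <->
  forall x, A x -> exists2 r, 0 < r & forall y, mdist x y < r -> A y.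
Proof.
rewrite openE; split=> [oA x /oA/nbhs_ballP[r r0 h]|h x /h[r r0 hr]].
  by exists r => // y xy; apply: h; rewrite ballEmdist.
by apply/nbhs_ballP; exists r => // y; rewrite ballEmdist; exact: hr.
Qed.

(** The distance to the complement of a set, truncated at 1 so that no case
    distinction is needed when the complement is empty. *)
Definition depth A (x : X) : R :=
  inf [set r | r = 1 \/ exists2 a, ~ A a & r = mdist x a].

Let depth_has_inf A x :
  has_inf [set r | r = 1 \/ exists2 a, ~ A a & r = mdist x a].
Proof.
split; first by exists 1; left.
by exists 0 => _ [->|[a _ ->]] //; exact: mdist_ge0.
Qed.

Lemma depth_ge0 A x : 0 <= depth A x.
Proof.
apply: lb_le_inf; first by exists 1; left.
by move=> _ [->|[a _ ->]] //; exact: mdist_ge0.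
Qed.

Lemma depth_le A x a : ~ A a -> depth A x <= mdist x a.
Proof. by move=> Aa; apply: ge_inf; [exact: (depth_has_inf A x).2|right; exists a]. Qed.

Lemma depth_le1 A x : depth A x <= 1.
Proof. by apply: ge_inf; [exact: (depth_has_inf A x).2|left]. Qed.

Lemma depth_out A x : ~ A x -> depth A x = 0.
Proof.
by move=> Ax; apply/eqP; rewrite eq_le depth_ge0 andbT -(mdistxx x) depth_le.
Qed.

Lemma depth_gt0 A x : open A -> A x -> 0 < depth A x.
Proof.
move=> /open_mdistP oA /oA[r r0 Ar].
apply: (@lt_le_trans _ _ (Num.min 1 r)); first by rewrite lt_min ltr01.
apply: lb_le_inf; first by exists 1; left.
move=> _ [->|[a Aa ->]]; first by rewrite ge_min lexx.
by rewrite ge_min; apply/orP; right; rewrite leNgt; apply/negP => /Ar.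
Qed.

Lemma depth_continuous A : continuous (depth A : X -> R^o).
Proof.
apply: lipschitz_continuous.
suff h x y : depth A x - depth A y <= mdist x y.
  move=> x y; rewrite ler_norml h andbT lerNl opprB metric_sym; exact: h.
rewrite lerBlDr addrC -lerBlDr; apply: lb_le_inf; first by exists 1; left.
move=> _ [->|[a Aa ->]]; rewrite lerBlDr.
  by rewrite (le_trans (depth_le1 A x))// lerDl mdist_ge0.
by rewrite (le_trans (depth_le x Aa))// addrC metric_triangle.
Qed.

(** For open A, these continuous functions increase to the indicator of A. *)
Definition ramp A (j : nat) (x : X) : R := Num.min 1 (j.+1%:R * depth A x).

Lemma ramp_continuous A j : continuous (ramp A j : X -> R^o).
Proof.
move=> x; suff : {for x, continuous ((cst 1 : X -> R^o) \min
    (fun y => j.+1%:R * depth A y : R^o))} by [].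
apply: continuous_min; first exact: cst_continuous.
by apply: continuousM; [exact: cst_continuous|exact: depth_continuous].
Qed.

Lemma ramp_ge0 A j x : 0 <= ramp A j x.
Proof. by rewrite le_min ler01 mulr_ge0// depth_ge0. Qed.

Lemma ramp_le1 A j x : ramp A j x <= 1.
Proof. by rewrite ge_min lexx. Qed.

Lemma ramp_out A j x : ~ A x -> ramp A j x = 0.
Proof. by move=> Ax; rewrite /ramp depth_out// mulr0 min_r. Qed.

Lemma ramp_nondecreasing A x : nondecreasing_seq (ramp A ^~ x).
Proof.
move=> i j ij; rewrite le_min ramp_le1/= ge_min; apply/orP; right.
by rewrite ler_wpM2r ?depth_ge0// ler_nat ltnS.
Qed.

Lemma ramp_cvg A x : open A -> A x -> ramp A j x @[j --> \oo] --> (1 : R^o).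
Proof.
move=> oA Ax; have d0 := depth_gt0 oA Ax.
apply: cvg_near_cst; exists (Num.trunc (depth A x)^-1) => // j /= ij.
rewrite /ramp min_l// -ler_pdivrMr// mul1r.
rewrite (le_trans (ltW (truncnS_gt _)))// ler_nat ltnS//.
Qed.

Hypothesis cX : compact [set: X].

(** Applied to filters on radii, bounds or indices, this form of compactness replaces
    the extraction of finite subcovers. *)
Lemma near_cover (I : Type) (F : set_system I) (P : I -> X -> Prop) :
  Filter F -> (forall x, \forall x' \near (x : X) & i \near F, P i x') ->
  \forall i \near F, forall x, P i x.
Proof.
move=> FF h; have /compact_near_coveringP/(_ _ _ P FF) := cX.
by move=> /(_ (fun x _ => h x)); apply: filterS => i Pi x; exact: Pi.
Qed.

Lemma uniformly_continuous g e : continuous g -> 0 < e ->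
  exists2 d, 0 < d & forall x y, mdist x y < d -> `|g x - g y| < e.
Proof.
move=> /continuous_mdistP cg e0.
have e20 : 0 < e / 2 by rewrite divr_gt0.
have : \forall d \near 0^'+, forall x y, mdist x y < d -> `|g x - g y| < e.
  apply: (near_cover (P := fun d x => forall y, mdist x y < d -> _)) => x.
  have [d d0 hd] := cg x _ e20.
  exists ([set x' | mdist x x' < d / 2], [set r | r < d / 2]) => /=.
    split; last by apply: nbhs_right_lt; rewrite divr_gt0.
    apply/nbhs_ballP; exists (d / 2) => /=; first by rewrite divr_gt0.
    by move=> y; rewrite ballEmdist.
  move=> [x' r] /= [xx' rd] y x'y.
  rewrite (splitr e) (le_lt_trans (ler_distD (g x) _ _))// ltrD//.
    by rewrite distrC hd// (lt_trans xx')// ltr_pdivrMr// ltr_pMr// ltr1n.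
  rewrite hd// (le_lt_trans (metric_triangle _ x' _))// (splitr d) ltrD//.
  exact: lt_trans rd.
by move=> h; near (0:R)^'+ => d; exists d => //; near: d.
Unshelve. all: by end_near. Qed.

Lemma continuous_bounded g : continuous g -> exists K, forall x, `|g x| <= K.
Proof.
move=> /continuous_mdistP cg.
have : \forall K \near +oo, forall x, `|g x| <= K.
  apply: (near_cover (P := fun K x => `|g x| <= K)) => x.
  have [d d0 hd] := cg x _ ltr01.
  exists ([set x' | mdist x x' < d], [set K | `|g x| + 1 < K]) => /=.
    split; last by exact: nbhs_pinfty_gt.
    by apply/nbhs_ballP; exists d => // y; rewrite ballEmdist.
  move=> [x' K] /= [xx' /ltW gK]; apply: le_trans gK.
  rewrite -lerBlDl (le_trans (lerB_dist _ _))// distrC.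
  exact/ltW/hd.
by move=> h; near (+oo : set_system R) => K; exists K; near: K.
Unshelve. all: by end_near. Qed.

Lemma finite_net r : 0 < r ->
  exists s : seq X, forall x, exists2 c, c \in s & mdist c x < r.
Proof.
move=> r0; have := cX; rewrite compact_cover.
move=> /(_ X setT (fun c => (ball c r)^°)) [c _|x _|s _ hs].
- exact: open_interior.
- by exists x => //; exact: nbhsx_ballx.
- exists (finmap.enum_fset s) => x; have [c /= sc] := hs x Logic.I.
  by move=> /interior_subset; rewrite ballEmdist => ?; exists c.
Qed.

End metric.

(** * Integrals of continuous functions *)

Lemma continuous_sum (R : realType) (Y : topologicalType) (I : Type) (s : seq I)
    (F : I -> Y -> R^o) : (forall i, continuous (F i)) ->
  continuous ((fun y => \sum_(i <- s) F i y) : Y -> R^o).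
Proof.
move=> cF; elim: s => [|i s IH].
  rewrite (_ : (fun _ => _) = cst 0); first by move=> y; exact: cst_continuous.
  by apply/funext => y; rewrite big_nil.
rewrite (_ : (fun _ => _) = F i \+ (fun y => \sum_(i <- s) F i y)).
  by move=> y; apply: continuousD; [exact: cF|exact: IH].
by apply/funext => y; rewrite big_cons.
Qed.

Definition mean (R : realType) (X : ptopologicalType)
  (mu : borel_probability R X) (g : X -> R^o) : R :=
  \int[mu]_(x in [set: borel X]) g x.

Section mean.
Context (R : realType) (X : pmetricType R).
Hypothesis cX : compact [set: X].
Local Notation M := (borel_probability R X).
Implicit Types (mu nu : M) (g h : X -> R^o) (U : set X).

Lemma continuous_bounded_near g : continuous g -> [bounded g y | y in [set: X]].
Proof.
move=> /(continuous_bounded cX)[K hK].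
rewrite /bounded_near; near=> L => x _ /=.
by rewrite (le_trans (hK x))//; near: L; exact: nbhs_pinfty_ge.
Unshelve. all: by end_near. Qed.

Lemma mean_integrable mu g : continuous g ->
  mu.-integrable [set: borel X] (EFin \o g).
Proof.
move=> cg; apply: measurable_bounded_integrable => //.
- by apply: (le_lt_trans (probability_le1 mu _)) => //; rewrite ltry.
- exact: continuous_measurable_borel.
- exact: continuous_bounded_near.
Qed.

Lemma meanE mu g : continuous g ->
  (mean mu g)%:E = (\int[mu]_(x in [set: borel X]) (g x)%:E)%E.
Proof.
by move=> cg; rewrite fineK//; exact: integrable_fin_num (mean_integrable _ cg).
Qed.

Lemma mean_ge0 mu g : (forall x, 0 <= g x) -> 0 <= mean mu g.
Proof. by move=> g0; exact: Rintegral_ge0. Qed.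

Lemma mean_le mu g h : continuous g -> continuous h ->
  (forall x, g x <= h x) -> mean mu g <= mean mu h.
Proof. by move=> cg ch gh; apply: le_Rintegral => //; exact: mean_integrable. Qed.

Lemma mean_cst mu (a : R) : mean mu (cst a) = a.
Proof.
rewrite /mean Rintegral_cst// [X in fine X](_ : _ = 1%E) ?mulr1//.
exact: (probability_setT mu).
Qed.

Lemma meanD mu g h : continuous g -> continuous h ->
  mean mu (fun x => g x + h x) = mean mu g + mean mu h.
Proof. by move=> cg ch; apply: RintegralD => //; exact: mean_integrable. Qed.

Lemma meanZ mu (a : R) g : continuous g ->
  mean mu (fun x => a * g x) = a * mean mu g.
Proof. by move=> cg; apply: RintegralZl => //; exact: mean_integrable. Qed.

Lemma mean_sum mu (I : Type) (s : seq I) (F : I -> X -> R^o) :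
  (forall i, continuous (F i)) ->
  mean mu (fun x => \sum_(i <- s) F i x) = \sum_(i <- s) mean mu (F i).
Proof.
move=> cF; elim: s => [|i s IH].
  rewrite big_nil -[RHS](mean_cst mu 0); congr mean.
  by apply/funext => x; rewrite big_nil.
rewrite big_cons -IH -meanD//; last exact: continuous_sum.
by congr mean; apply/funext => x; rewrite big_cons.
Qed.

Lemma mean_dist mu g h e : continuous g -> continuous h ->
  (forall x, `|g x - h x| <= e) -> `|mean mu g - mean mu h| <= e.
Proof.
move=> cg ch gh; rewrite ler_distl lerBlDr.
have ce : continuous (cst e : X -> R^o) by move=> x; exact: cst_continuous.
have hs k : mean mu k + e = mean mu k + mean mu (cst e) by rewrite mean_cst.
rewrite !hs -!meanD//; apply/andP; split; apply: mean_le => //.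
- by move=> x; apply: continuousD; [exact: cg|exact: ce].
- by move=> x; have := gh x; rewrite ler_distl lerBlDr => /andP[].
- by move=> x; apply: continuousD; [exact: ch|exact: ce].
- by move=> x; have := gh x; rewrite ler_distl => /andP[].
Qed.

Lemma continuous_mean g : continuous g ->
  continuous ((fun mu => mean mu g) : M -> R^o).
Proof.
move=> cg mu.
pose b : bounded_continuous R X := exist _ g (conj cg (continuous_bounded_near cg)).
suff : test_integrals nu b @[nu --> mu] --> test_integrals mu b by [].
have : test_integrals nu @[nu --> mu] --> test_integrals mu.
  exact: (@initial_continuous _ _ (@test_integrals R X)).
have FF : Filter (nbhs mu) by exact: nbhs_filter.
have FF' := @fmap_filter _ _ (@test_integrals R X) _ FF.
rewrite cvg_sup => /(_ b); rewrite cvg_image; last first.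
  by rewrite eqEsubset; split=> v // _; exists (cst v).
apply: cvg_trans => W /=; rewrite ?nbhs_simpl /fmap /= => [[W' + <-]].
by apply: filterS => z W'g /=; exists (test_integrals z).
Qed.

Lemma measurable_mean g : continuous g ->
  measurable_fun [set: borel M] ((fun mu => mean mu g) : borel M -> R).
Proof. by move=> cg; apply: continuous_measurable_borel; exact: continuous_mean. Qed.

Lemma cvg_meanP (u : nat -> M) mu :
  (u n @[n --> \oo] --> mu) <-> (forall g, continuous g ->
    mean (u n) g @[n --> \oo] --> (mean mu g : R^o)).
Proof.
rewrite borel_probability_cvgP; split=> [h g cg|h [g [cg bg]]]; last exact: h.
exact: (h (exist _ g (conj cg (continuous_bounded_near cg)))).
Qed.

Lemma mean_ramp_cvg mu U : open U ->
  (mean mu (ramp U j))%:E @[j --> \oo] --> mu U.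
Proof.
move=> oU.
have mU : measurable (U : set (borel X)) by exact: sub_sigma_algebra.
have meanE' j := meanE mu (@ramp_continuous R X U j).
under eq_fun do rewrite meanE'.
rewrite (_ : mu U =
    \int[mu]_(x in [set: borel X]) limn (fun j => (ramp U j x)%:E))%E; last first.
  rewrite -[in LHS](setIT U) -integral_indic//; apply: eq_integral => x _.
  apply/esym/cvg_lim => //; apply/cvg_EFin; first exact: nearW.
  rewrite indicE; have [Ux|Ux] := pselect (U x).
    by rewrite mem_set//; exact: ramp_cvg.
  rewrite memNset//; apply: cvg_near_cst; apply: nearW => j /=.
  by rewrite ramp_out.
apply: cvg_monotone_convergence => //.
- move=> n; apply/measurable_EFinP.
  by apply: continuous_measurable_borel; exact: ramp_continuous.
- by move=> n x _; rewrite lee_fin ramp_ge0.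
- by move=> x _ i j ij; rewrite lee_fin; exact: ramp_nondecreasing.
Qed.

Lemma mean_le_measure mu g U : continuous g -> open U ->
  (forall x, 0 <= g x <= 1) -> (forall x, ~ U x -> g x = 0) ->
  ((mean mu g)%:E <= mu U)%E.
Proof.
move=> cg oU g01 gU; rewrite meanE//.
have mU : measurable (U : set (borel X)) by exact: sub_sigma_algebra.
rewrite -[in leRHS](setIT U) -integral_indic//.
apply: le_lower_integral => x; rewrite lee_fin; first by have /andP[] := g01 x.
rewrite indicE; have [Ux|Ux] := pselect (U x).
  by rewrite mem_set//; have /andP[] := g01 x.
by rewrite memNset// gU.
Qed.

Lemma mean_gt_open mu U (c : \bar R) : open U -> (c < mu U)%E ->
  exists g, [/\ continuous g, forall x, 0 <= g x <= 1,
    forall x, ~ U x -> g x = 0 & (c < (mean mu g)%:E)%E].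
Proof.
move=> oU cU; have := @mean_ramp_cvg mu U oU.
move=> /(_ [set r | (c < r)%E]) [|j _ /(_ j (leqnn _)) /= cj].
  by apply: open_nbhs_nbhs; split => //; exact: open_ereal_gt_ereal.
exists (ramp U j); split => //; first exact: ramp_continuous.
- by move=> x; rewrite ramp_ge0 ramp_le1.
- by move=> x; exact: ramp_out.
Qed.

Lemma mean_inj mu nu :
  (forall g, continuous g -> mean mu g = mean nu g) -> mu = nu.
Proof.
move=> h; apply: borel_probability_ext.
move=> A mA.
refine (@g_sigma_algebra_measure_unique _ R (borel X) (@open X) _ (fun=> setT)
  _ _ mu nu _ _ _ A mA) => //.
- by move=> U oU; exact: sub_sigma_algebra.
- by move=> _; exact: openT.
- by rewrite bigcup_const.
- by move=> B C; exact: openI.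
- move=> U oU; apply: (cvg_unique _ (@mean_ramp_cvg mu U oU)) => //.
  rewrite (_ : (fun j => _) = fun j => (mean nu (ramp U j))%:E).
    exact: mean_ramp_cvg.
  by apply/funext => j; rewrite h//; exact: ramp_continuous.
- by move=> _; apply: (le_lt_trans (probability_le1 mu _)); rewrite ?ltry.
Qed.

End mean.

(** * Partitions of unity and the Borel sets of the space of measures *)

Section partition_of_unity.
Context (R : realType) (X : pmetricType R).
Hypothesis cX : compact [set: X].
Local Notation M := (borel_probability R X).
Implicit Types (mu nu : M) (g : X -> R^o).

Let radius_gt0 n : 0 < n.+1%:R^-1 :> R.
Proof. by rewrite invr_gt0. Qed.

Definition net n : seq X := sval (cid (finite_net cX (radius_gt0 n))).

Definition center n i : X := nth point (net n) i.

Lemma netP n x : exists2 i, (i < size (net n))%N &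
  mdist (center n i) x < n.+1%:R^-1.
Proof.
have [c cs cx] := svalP (cid (finite_net cX (radius_gt0 n))) x.
exists (index c (net n)); first by rewrite index_mem.
by rewrite /center nth_index.
Qed.

Let tent n i (x : X) : R^o := Num.max 0 (n.+1%:R^-1 - mdist (center n i) x).

Let tent_ge0 n i x : 0 <= tent n i x.
Proof. by rewrite le_max lexx. Qed.

Let continuous_tent n i : continuous (tent n i).
Proof.
move=> x; suff : {for x, continuous ((cst 0 : X -> R^o) \max
    (fun y => n.+1%:R^-1 - mdist (center n i) y : R^o))} by [].
apply: continuous_max; first exact: cst_continuous.
by apply: continuousB; [exact: cst_continuous|exact: mdist_continuous].
Qed.

Let tents n (x : X) : R^o := \sum_(i <- iota 0 (size (net n))) tent n i x.

Let tents_gt0 n x : 0 < tents n x.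
Proof.
have [i i_lt ix] := netP n x.
have ii : i \in iota 0 (size (net n)) by rewrite mem_iota.
rewrite /tents (big_rem i ii)/= ltr_wpDr//; first exact: sumr_ge0.
by rewrite lt_max subr_gt0 ix orbT.
Qed.

(** A partition of unity subordinate to the balls of radius 1 / (n + 1) around the
    points of the n-th net. *)
Definition pou n i (x : X) : R^o := tent n i x / tents n x.

Lemma pou_continuous n i : continuous (pou n i).
Proof.
move=> x; apply: continuousM; first exact: continuous_tent.
apply: continuousV; first by rewrite gt_eqF.
exact: continuous_sum.
Qed.

Lemma pou_ge0 n i x : 0 <= pou n i x.
Proof. by rewrite mulr_ge0// invr_ge0 ltW. Qed.

Lemma sum_pou n x : \sum_(i <- iota 0 (size (net n))) pou n i x = 1.
Proof. by rewrite -mulr_suml; apply: mulfV; rewrite gt_eqF// tents_gt0. Qed.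

Lemma pou_out n i x : n.+1%:R^-1 <= mdist (center n i) x -> pou n i x = 0.
Proof. by move=> h; rewrite /pou /tent max_l ?mul0r// subr_le0. Qed.

Lemma small_radius (e : R) : 0 < e -> exists n, n.+1%:R^-1 < e.
Proof.
move=> e0; exists (Num.trunc e^-1); rewrite -[ltRHS]invrK.
by rewrite ltf_pV2 ?posrE ?invr_gt0//; exact: truncnS_gt.
Qed.

Lemma pou_approx g e : continuous g -> 0 < e -> exists n, forall x,
  `|g x - \sum_(i <- iota 0 (size (net n))) g (center n i) * pou n i x| <= e.
Proof.
move=> cg e0; have [d d0 gd] := uniformly_continuous cX cg e0.
have [n nd] := small_radius d0; exists n => x.
rewrite -[g x]mulr1 -(sum_pou n x) mulr_sumr -sumrB.
rewrite (le_trans (ler_norm_sum _ _ _))//.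
rewrite -[leRHS]mulr1 -(sum_pou n x) mulr_sumr; apply: ler_sum => i _.
rewrite -mulrBl normrM (ger0_norm (pou_ge0 _ _ _)).
have [cx|cx] := ltP (mdist (center n i) x) n.+1%:R^-1.
  by rewrite ler_wpM2r ?pou_ge0// distrC ltW// gd// (lt_trans cx).
by rewrite pou_out// !mulr0.
Qed.

Let continuous_scaled_pou (a : nat -> R) n (s : seq nat) :
  continuous ((fun x => \sum_(i <- s) a i * pou n i x) : X -> R^o).
Proof.
apply: continuous_sum => i x.
by apply: continuousM; [exact: cst_continuous|exact: pou_continuous].
Qed.

Lemma mean_pou_approx g e : continuous g -> 0 < e -> exists n, forall mu,
  `|mean mu g - \sum_(i <- iota 0 (size (net n)))
      g (center n i) * mean mu (pou n i)| <= e.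
Proof.
move=> cg e0; have [n gn] := pou_approx cg e0; exists n => mu.
rewrite (eq_bigr (fun i => mean mu (fun x => g (center n i) * pou n i x)));
  last by move=> i _; rewrite meanZ//; exact: pou_continuous.
rewrite -mean_sum//; last first.
  move=> i x; apply: continuousM; [exact: cst_continuous|exact: pou_continuous].
by apply: mean_dist => //; exact: continuous_scaled_pou.
Qed.

(** The integrals of the countably many functions [pou n i] control the integral
    of any continuous function, uniformly over all pairs of measures. *)
Lemma mean_near g e : continuous g -> 0 < e ->
  exists n, exists2 eta, 0 < eta & forall mu nu,
    (forall i, (i < size (net n))%N ->
      `|mean mu (pou n i) - mean nu (pou n i)| < eta) ->
    `|mean mu g - mean nu g| < e.
Proof.
move=> cg e0; have e40 : 0 < e / 4 by rewrite divr_gt0.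
have [n gn] := mean_pou_approx cg e40.
set S := \sum_(i <- iota 0 (size (net n))) `|g (center n i)|.
have S0 : 0 <= S by exact: sumr_ge0.
exists n, (e / 4 / (1 + S)); first by rewrite divr_gt0// ltr_pwDl.
move=> mu nu munu.
set P := fun mu => \sum_(i <- iota 0 (size (net n)))
  g (center n i) * mean mu (pou n i).
have Pe : `|P mu - P nu| <= e / 4.
  rewrite /P -sumrB (le_trans (ler_norm_sum _ _ _))//.
  apply: (@le_trans _ _ (e / 4 / (1 + S) * S)); last first.
    rewrite mulrAC ler_pdivrMr ?ltr_pwDl// ler_wpM2l ?(ltW e40)//.
    by rewrite lerDr.
  rewrite mulr_sumr big_seq [leRHS]big_seq; apply: ler_sum => i.
  rewrite mem_iota/= add0n => i_lt; rewrite -mulrBr normrM mulrC.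
  by rewrite ler_wpM2r// ltW// munu.
have -> : mean mu g - mean nu g =
    (mean mu g - P mu) + (P mu - P nu) + (P nu - mean nu g) by ring.
have := gn mu; have := gn nu; rewrite -!/(P _) distrC => gnu gmu.
rewrite (le_lt_trans (ler_normD _ _))//.
rewrite (le_lt_trans (lerD (ler_normD _ _) (lexx _)))//.
rewrite (le_lt_trans (lerD (lerD gmu Pe) gnu))//; lra.
Qed.

Lemma measurable_mean_pou (p : nat * nat) :
  measurable_fun [set: borel M] ((fun mu => mean mu (pou p.1 p.2)) : borel M -> R).
Proof. by apply: measurable_mean => //; exact: pou_continuous. Qed.

(** Weakly open sets are open for the topology induced by the countable family
    [pou]: otherwise a sequence outside the set would converge weakly to one of
    its points. *)
Lemma open_pou (O : set M) mu : open O -> O mu ->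
  exists s : seq (nat * nat), exists2 eta, 0 < eta & forall nu,
    (forall p, p \in s ->
      `|mean nu (pou p.1 p.2) - mean mu (pou p.1 p.2)| < eta) -> O nu.
Proof.
move=> oO Omu; apply: contrapT => hO.
pose close m nu := forall p, (p.1 < m)%N && (p.2 < m)%N ->
  `|mean nu (pou p.1 p.2) - mean mu (pou p.1 p.2)| < m.+1%:R^-1.
have far m : exists nu, close m nu /\ ~ O nu.
  apply: contrapT => /forallNP hm; apply: hO.
  exists [seq (i, j) | i <- iota 0 m, j <- iota 0 m], (m.+1%:R^-1) => // nu hnu.
  apply: contrapT => Onu; apply: (hm nu); split => // -[i j] /= /andP[im jm].
  apply: (hnu (i, j)); apply/allpairsP; exists (i, j).
  by rewrite !mem_iota.
have [u uP] := choice far.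
suff /(_ O) : u n @[n --> \oo] --> mu.
  move=> /(_ (open_nbhs_nbhs (conj oO Omu)))[N _ /(_ N (leqnn N))].
  exact: (uP N).2.
apply/(cvg_meanP cX) => g cg; apply/cvgrPdist_lt => e e0.
have [n [eta eta0 hn]] := mean_near cg e0.
have [N1 N1eta] := small_radius eta0.
exists (maxn (maxn n.+1 (size (net n))) N1) => // m /=.
rewrite !geq_max => /andP[/andP[nm sm] N1m]; apply: hn => i i_lt.
rewrite distrC (lt_le_trans ((uP m).1 (n, i) _))//=.
  by rewrite nm (leq_trans i_lt).
by rewrite (le_trans _ (ltW N1eta))// lef_pV2 ?posrE// ler_nat.
Qed.

(** Hence the Borel sets of the space of measures are generated by the integrals of
    the functions [pou n i]. *)
Lemma measurable_borel_measures d (T : measurableType d) (e : T -> M) :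
  (forall n i, measurable_fun [set: T] (fun x => mean (e x) (pou n i))) ->
  measurable_fun [set: T] (e : T -> borel M).
Proof.
move=> me; apply: (@measurability _ _ T (borel M) setT e (@open M) erefl) => // _ [V oV <-]; rewrite setTI.
apply: (measurable_separated
  (h := fun (p : nat * nat) x => mean (e x) (pou p.1 p.2))) => // x Vx.
have [s [eta eta0 hs]] := open_pou oV Vx.
by exists s, eta => // y hy; exact: hs.
Qed.

(** The integrals of the functions [pou n i] separate the measures. *)
Lemma measurable_singleton mu : measurable ([set mu] : set (borel M)).
Proof.
rewrite (_ : [set mu] = \bigcap_n \bigcap_i
    [set nu | mean nu (pou n i) = mean mu (pou n i)]); last first.
  apply/seteqP; split=> [_ ->|nu h] //.
  apply: (mean_inj cX) => g cg; apply/eqP; rewrite -subr_eq0 -normr_le0.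
  apply/ler_addgt0Pl => e e0; rewrite addr0.
  have [n [eta eta0 hn]] := mean_near cg e0.
  apply/ltW/hn => i _; have /= -> := h n Logic.I i Logic.I.
  by rewrite subrr normr0.
apply: bigcapT_measurable => n; apply: bigcapT_measurable => i.
rewrite -[X in measurable X]setTI.
exact: (measurable_mean_pou (n, i) measurableT
  (measurable_set1 (mean mu (pou n i)))).
Qed.

End partition_of_unity.

Section open_sets.
Context (R : realType) (X : pmetricType R).
Hypothesis cX : compact [set: X].
Local Notation M := (borel_probability R X).

(** The mass of an open set is the supremum of the integrals of continuous functions
    below its indicator, hence lower semicontinuous. *)
Lemma open_measure_gt (U : set X) (c : \bar R) :
  open U -> open [set mu : M | (c < mu U)%E].
Proof.
move=> oU; rewrite openE => mu /= /(mean_gt_open cX oU)[g [cg g01 gU cmu]].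
have oO : open [set nu | (c < (mean nu g)%:E)%E].
  have /continuousP/(_ [set r | (c < r%:E)%E]) := continuous_mean cX cg.
  by apply; exact: open_ereal_gt.
apply: (filterS _ (open_nbhs_nbhs (conj oO cmu))) => nu /= /lt_le_trans; apply.
exact: mean_le_measure.
Qed.

Lemma measurable_measure_open (U : set X) : open U ->
  measurable_fun [set: borel M] ((fun nu : M => nu U) : borel M -> \bar R).
Proof.
move=> oU; apply: (measurability _ (ErealGenOInfty.measurableE R)).
move=> _ [_ [a ->] <-]; rewrite setTI; apply: sub_sigma_algebra.
rewrite (_ : _ @^-1` _ = [set mu : M | (a%:E < mu U)%E]).
  exact: open_measure_gt.
by apply/seteqP; split=> mu /=; rewrite in_itv/= andbT.
Qed.

End open_sets.

(** * Positive functionals are measures *)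

Section riesz.
Context (R : realType) (X : pmetricType R).
Hypothesis cX : compact [set: X].
Variable L : (X -> R^o) -> R.
Implicit Types (g h : X -> R^o) (U V A : set X).
Hypothesis LD : forall g h, continuous g -> continuous h ->
  L (fun x => g x + h x) = L g + L h.
Hypothesis LZ : forall (a : R) g, continuous g ->
  L (fun x => a * g x) = a * L g.
Hypothesis L_ge0 : forall g, continuous g -> (forall x, 0 <= g x) -> 0 <= L g.
Hypothesis L_cst1 : L (cst 1) = 1.

Let cc (a : R) : continuous (cst a : X -> R^o).
Proof. by move=> x; exact: cst_continuous. Qed.

Let cD g h : continuous g -> continuous h -> continuous (fun x => g x + h x : R^o).
Proof. by move=> cg ch x; apply: continuousD; [exact: cg|exact: ch]. Qed.

Let cM g h : continuous g -> continuous h -> continuous (fun x => g x * h x : R^o).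
Proof. by move=> cg ch x; apply: continuousM; [exact: cg|exact: ch]. Qed.

Let L_cst a : L (cst a) = a.
Proof.
rewrite -[RHS]mulr1 -L_cst1 -LZ//; congr L; apply/funext => x /=.
by rewrite mulr1.
Qed.

Let L_le g h : continuous g -> continuous h -> (forall x, g x <= h x) ->
  L g <= L h.
Proof.
move=> cg ch gh; rewrite -subr_ge0.
have c1 : continuous (fun x => -1 * g x : R^o).
  exact: (@cM (cst (-1)) g (@cc (-1)) cg).
have -> : L h - L g = L (fun x => h x + -1 * g x).
  by rewrite LD// LZ// mulN1r.
apply: L_ge0; first exact: cD.
by move=> x; rewrite mulN1r subr_ge0.
Qed.

Let L_sum (F : nat -> X -> R^o) (s : seq nat) : (forall i, continuous (F i)) ->
  L (fun x => \sum_(i <- s) F i x) = \sum_(i <- s) L (F i).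
Proof.
move=> cF; elim: s => [|i s IH].
  rewrite big_nil -[RHS]L_cst; congr L.
  by apply/funext => x; rewrite big_nil.
rewrite big_cons -IH -LD//; last by apply: continuous_sum.
by congr L; apply/funext => x; rewrite big_cons.
Qed.

Let tests U g :=
  [/\ continuous g, forall x, 0 <= g x <= 1 & forall x, ~ U x -> g x = 0].

Let inner U : \bar R := ereal_sup [set (L g)%:E | g in tests U].

(** The representing measure is prescribed on open sets by the test functions that
    they carry, and extended to all sets by outer regularity. *)
Definition riesz_outer A : \bar R :=
  ereal_inf [set inner U | U in [set U | open U /\ A `<=` U]].

Let inner_ub U g : tests U g -> ((L g)%:E <= inner U)%E.
Proof. by move=> Ug; apply: ereal_sup_ubound; exists g. Qed.

Let tests0 U : tests U (cst 0).
Proof. by split=> // x; rewrite lexx ler01. Qed.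

Let inner_ge0 U : (0 <= inner U)%E.
Proof. by rewrite -[0%E]/(0%R%:E) -(L_cst 0) inner_ub. Qed.

Let inner_le1 U : (inner U <= 1)%E.
Proof.
apply: ge_ereal_sup => _ [g [cg g01 _] <-].
by rewrite lee_fin -L_cst1 L_le// => x; have /andP[] := g01 x.
Qed.

Let le_inner U V : U `<=` V -> (inner U <= inner V)%E.
Proof.
move=> UV; apply: ereal_sup_le => _ [g [cg g01 gU] <-]; exists g => //.
by split => // x Vx; apply: gU => /UV.
Qed.

Let outer_open U : open U -> riesz_outer U = inner U.
Proof.
move=> oU; apply/eqP; rewrite eq_le; apply/andP; split.
  by apply: ereal_inf_lbound; exists U => //; split.
by apply: le_ereal_inf_tmp => _ [V [_ UV] <-]; exact: le_inner.
Qed.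

Let shave g (e : R) (x : X) : R^o := Num.max 0 (g x - e).

Let continuous_shave g e : continuous g -> continuous (shave g e).
Proof.
move=> cg x; suff : {for x, continuous ((cst 0 : X -> R^o) \max
    (fun y => g y - e : R^o))} by [].
apply: continuous_max; first exact: cst_continuous.
by apply: continuousB; [exact: cg|exact: cst_continuous].
Qed.

Let shave_ge0 g e x : 0 <= shave g e x.
Proof. by rewrite le_max lexx. Qed.

Let le_shave g e x : g x <= shave g e x + e.
Proof. by rewrite -lerBlDr le_max lexx orbT. Qed.

Let shave_le g e x : 0 <= e -> 0 <= g x -> shave g e x <= g x.
Proof. by move=> e0 g0; rewrite ge_max g0 lerBlDr lerDl. Qed.

Let L_shave g e : continuous g -> L g <= L (shave g e) + e.
Proof.
move=> cg; have -> : L (shave g e) + e = L (fun x => shave g e x + cst e x).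
  by rewrite LD// ?L_cst//; exact: continuous_shave.
apply: L_le => //.
by apply: (@cD (shave g e) (cst e)) => //; exact: continuous_shave.
Qed.

(** A test function for a union of open sets is, up to a small constant,
    supported on a compact set and then splits along a partition of unity into
    test functions for finitely many of the open sets. *)
Let inner_bigcup (U : nat -> set X) : (forall i, open (U i)) ->
  (inner (\bigcup_i U i) <= \sum_(i <oo) inner (U i))%E.
Proof.
move=> oU; apply: ge_ereal_sup => _ [g [cg g01 gU] <-].
apply/lee_addgt0Pr => e e0.
have [n hn] : exists n, forall x, g x < e \/ exists2 i, (i < n)%N & U i x.
  have : \forall n \near \oo, forall x,
      g x < e \/ exists2 i, (i < n)%N & U i x.
    apply: (near_cover cX
      (P := fun n x => g x < e \/ exists2 i, (i < n)%N & U i x)) => x.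
    have [gx|gx] := ltP (g x) e.
      have eg : 0 < e - g x by rewrite subr_gt0.
      have [d d0 hd] := (continuous_mdistP g).1 cg x _ eg.
      exists ([set x' | mdist x x' < d], setT) => /=.
        split; last exact: filterT.
        by apply/nbhs_ballP; exists d => // y; rewrite ballEmdist.
      move=> [x' k] /= [/hd + _]; rewrite distrC ltr_distl => /andP[_ h]; left.
      by rewrite addrC subrK in h.
    have [i _ Ux] : (\bigcup_i U i) x.
      by apply: contrapT => /gU g0; move: gx; rewrite g0 leNgt e0.
    exists (U i, [set k | (i < k)%N]) => /=.
      by split; [apply: open_nbhs_nbhs; split|exists i.+1].
    by move=> [x' k] /= [Ux' ik]; right; exists i.
  by move=> [n _ /(_ n (leqnn n))] hn; exists n.
pose s := iota 0 n.
pose S x : R^o := \sum_(i <- s) depth (U i) x.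
(* D is positive everywhere and equals S wherever shave g e is nonzero. *)
pose D x : R^o := S x + Num.max 0 (e - g x).
have S_ge0 x : 0 <= S x by apply: sumr_ge0 => i _; exact: depth_ge0.
have le_S i x : i \in s -> depth (U i) x <= S x.
  move=> si; rewrite /S (big_rem i si)/= lerDl.
  by apply: sumr_ge0 => j _; exact: depth_ge0.
have D_gt0 x : 0 < D x.
  have [gx|[i i_lt Ux]] := hn x.
    by rewrite ltr_wpDl// lt_max subr_gt0 gx orbT.
  rewrite ltr_pwDl ?le_max ?lexx// (lt_le_trans (depth_gt0 (oU i) Ux))//.
  by apply: le_S; rewrite mem_iota.
have cS : continuous S by apply: continuous_sum => i; exact: depth_continuous.
have cDD : continuous D.
  apply: (@cD S (fun x => Num.max 0 (e - g x))) => // x; suff : {for x, continuous ((cst 0 : X -> R^o) \max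
    (fun y => e - g y : R^o))} by [].
  apply: continuous_max; first exact: cst_continuous.
  by apply: continuousB; [exact: cst_continuous|exact: cg].
pose h i x : R^o := shave g e x * (depth (U i) x / D x).
have ch i : continuous (h i).
  apply: (@cM (shave g e)); first exact: continuous_shave.
  move=> x; apply: continuousM; first exact: depth_continuous.
  by apply: continuousV; [rewrite gt_eqF|exact: cDD].
have sum_h x : \sum_(i <- s) h i x = shave g e x.
  rewrite -mulr_sumr -mulr_suml.
  have [ge|ge] := leP (g x) e.
    by rewrite /shave max_l ?mul0r// subr_le0.
  have -> : \sum_(i <- s) depth (U i) x = D x.
    by rewrite /D max_l ?addr0// subr_le0 ltW.
  by rewrite mulfV ?mulr1// gt_eqF.
have hU i : i \in s -> tests (U i) (h i).
  move=> si; split => // x.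
    have d01 : 0 <= depth (U i) x / D x <= 1.
      apply/andP; split; first by rewrite divr_ge0 ?depth_ge0// ltW.
      rewrite ler_pdivrMr// mul1r.
      by rewrite (le_trans (le_S i x si))// lerDl le_max lexx.
    have /andP[d0 d1] := d01; have /andP[g0 g1] := g01 x.
    rewrite mulr_ge0//= mulr_ile1//.
    by rewrite (le_trans _ g1)// shave_le// ltW.
  by move=> Ux; rewrite /h depth_out// mul0r mulr0.
rewrite (@le_trans _ _ ((\sum_(i <- s) L (h i))%:E + e%:E)%E)//.
  rewrite -EFinD lee_fin -L_sum// (le_trans (L_shave e cg))// lerD2r.
  by rewrite le_eqVlt; apply/orP; left; apply/eqP; congr L; apply/funext => x.
rewrite leeD2r//.
apply: le_trans (nneseries_lim_ge (P := xpredT) (m := 0) n _) => //.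
rewrite -sumEFin /index_iota subn0 big_seq [leRHS]big_seq.
by apply: lee_sum => i si; exact/inner_ub/hU.
Qed.

Let outer_ge0 A : (0 <= riesz_outer A)%E.
Proof. by apply: le_ereal_inf_tmp => _ [U _ <-]. Qed.

Let outer0 : riesz_outer set0 = 0%E.
Proof.
rewrite outer_open; last exact: open0.
apply/eqP; rewrite eq_le inner_ge0 andbT; apply: ge_ereal_sup => _ [g [cg _ g0] <-].
rewrite (_ : g = cst 0) ?L_cst//; apply/funext => x; exact: g0.
Qed.

Let le_outer : {homo riesz_outer : A B / A `<=` B >-> (A <= B)%E}.
Proof.
move=> A B AB; apply: ereal_inf_le_tmp => _ [U [oU BU] <-]; exists U => //.
by split => //; exact: subset_trans BU.
Qed.

Let outer_le1 A : (riesz_outer A <= 1)%E.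
Proof.
apply: le_trans (inner_le1 setT); apply: ereal_inf_lbound; exists setT => //.
by split => //; exact: openT.
Qed.

Let outer_sigma_subadditive : sigma_subadditive riesz_outer.
Proof.
move=> F; apply/lee_addgt0Pr => e e0.
have e2 i : (0 < e / (2 ^ i.+1)%:R) by rewrite divr_gt0// ltr0n expn_gt0.
have /choice[U hU] i : exists U, [/\ open U, F i `<=` U &
    (inner U <= riesz_outer (F i) + (e / (2 ^ i.+1)%:R)%:E)%E].
  have fin : riesz_outer (F i) \is a fin_num.
    by rewrite ge0_fin_numE// (le_lt_trans (outer_le1 _)) ?ltry.
  have [_ [U [oU FU] <-] /ltW hU] := lb_ereal_inf_adherent (e2 i) fin.
  by exists U.
apply: le_trans (epsilon_trick _ _ (ltW e0)); last first.
  by move=> n; exact: outer_ge0.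
apply: (@le_trans _ _ (inner (\bigcup_i U i))).
  apply: ereal_inf_lbound; exists (\bigcup_i U i) => //; split.
    by apply: bigcup_open => i _; have [] := hU i.
  by apply: subset_bigcup => i _; have [] := hU i.
apply: le_trans (inner_bigcup _) _; first by move=> i; have [] := hU i.
by apply: lee_nneseries => // i _; have [_ _] := hU i.
Qed.

HB.instance Definition _ := isOuterMeasure.Build R X riesz_outer
  outer0 outer_ge0 le_outer outer_sigma_subadditive.

(** When V is open and contains A, a test function g of the intersection of V and U,
    lowered by e, and a test function of the part of V where g < e add up to a test
    function of V; that part contains the points of A outside U. *)
Let open_caratheodory U : open U -> riesz_outer.-caratheodory U.
Proof.
move=> oU; apply: le_caratheodory_measurable => A.
apply: le_ereal_inf_tmp => _ [V [oV AV] <-].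
have oVU : open (V `&` U) by exact: openI.
apply: (@le_trans _ _ (inner (V `&` U) + riesz_outer (A `&` ~` U))%E).
  by rewrite leeD2r// -outer_open//; apply: le_outer; exact: setSI.
have fin : riesz_outer (A `&` ~` U) \is a fin_num.
  by rewrite ge0_fin_numE// (le_lt_trans (outer_le1 _)) ?ltry.
rewrite -leeBrDr//; apply: ge_ereal_sup => _ [g [cg g01 gVU] <-].
rewrite leeBrDr//; apply/lee_addgt0Pr => e e0.
pose W := V `&` [set x | g x < e].
have oW : open W.
  apply: openI => //; have /continuousP := cg.
  by move=> /(_ [set r | r < e]); apply; exact: open_lt.
have AW : A `&` ~` U `<=` W.
  move=> x [Ax Ux]; split; first exact: AV.
  by rewrite /= gVU// => -[].
apply: (@le_trans _ _ ((L g)%:E + inner W)%E).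
  by rewrite leeD2l// -outer_open//; exact: le_outer.
rewrite addeC -leeBrDr//; apply: ge_ereal_sup => _ [h [ch h01 hW] <-].
rewrite leeBrDr// -EFinD.
pose k x : R^o := shave g e x + h x.
have ck : continuous k.
  by apply: (@cD (shave g e)) => //; exact: continuous_shave.
have kV : tests V k.
  split => // x.
    have /andP[g0 g1] := g01 x; have /andP[h0 h1] := h01 x.
    rewrite addr_ge0//=; have [ge|ge] := ltP (g x) e.
      by rewrite /k /shave max_l ?add0r// subr_le0 ltW.
    rewrite /k hW ?addr0 ?(le_trans _ g1) ?shave_le ?(ltW e0)//.
    by move=> [_ /=]; rewrite ltNge ge.
  move=> Vx; rewrite /k hW ?addr0; last by move=> [].
  rewrite /shave gVU; last by move=> [].
  by rewrite max_l// sub0r oppr_le0 ltW.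
apply: (@le_trans _ _ ((L k)%:E + e%:E)%E); last by rewrite leeD2r// inner_ub.
rewrite -EFinD lee_fin LD//; last exact: continuous_shave.
by have := L_shave e cg; lra.
Qed.

Let borel_outer (A : set (borel X)) : \bar R := riesz_outer A.

Let borel_caratheodory (A : set (borel X)) :
  measurable A -> riesz_outer.-caratheodory A.
Proof.
move=> mA; pose G := riesz_outer.-cara.-measurable.
suff : <<s @open X >> `<=` G by exact.
apply: smallest_sub; first exact: sigma_algebra_measurable.
exact: open_caratheodory.
Qed.

Let borel_outer_sigma_additive : semi_sigma_additive borel_outer.
Proof.
move=> F mF tF mUF.
apply: (@caratheodory_measure_sigma_additive _ _ riesz_outer) => //.
  by move=> i; exact: borel_caratheodory.
exact: borel_caratheodory.
Qed.

HB.instance Definition _ := isMeasure.Build _ _ _ borel_outer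
  outer0 outer_ge0 borel_outer_sigma_additive.

Let borel_outerT : borel_outer setT = 1%E.
Proof.
rewrite /borel_outer outer_open; last exact: openT.
apply/eqP; rewrite eq_le inner_le1/= -[1%E]/(1%R%:E) -L_cst1 inner_ub//.
split=> [|x|x /(_ Logic.I)//]; first exact: cc.
by rewrite /= lexx ler01.
Qed.

(** Cutting g into N horizontal slices of height 1/N, each slice is bounded by
    the indicator of a level set, and the indicators add up to at most g + 1/N. *)
Let L_le_mean (mu : borel_probability R X) g :
  (forall U, open U -> mu U = inner U) ->
  continuous g -> (forall x, 0 <= g x <= 1) -> L g <= mean mu g.
Proof.
move=> muE cg g01; apply/ler_addgt0Pr => e e0.
have [m /ltW me] := small_radius e0; set N := m.+1.
apply: (@le_trans _ _ (mean mu g + N%:R^-1)); last by rewrite lerD2l.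
have N0 : 0 < N%:R^-1 :> R by rewrite invr_gt0.
pose level (i : nat) : R := i%:R / N%:R.
pose U i := [set x | level i < g x].
have oU i : open (U i).
  have /continuousP/(_ [set r | level i < r]) := cg; apply; exact: open_gt.
pose slice i x : R^o := Num.min N%:R^-1 (shave g (level i) x).
have cslice i : continuous (slice i).
  move=> x; suff : {for x, continuous ((cst N%:R^-1 : X -> R^o) \min
    shave g (level i))} by [].
  apply: continuous_min; first exact: cst_continuous.
  exact: continuous_shave.
have sum_slice k x : \sum_(i <- iota 0 k) slice i x = Num.min (g x) (level k).
  elim: k => [|k IH].
    rewrite big_nil /level mul0r min_r//; by have /andP[] := g01 x.
  rewrite -[in LHS]addn1 iotaD add0n big_cat/= big_seq1 IH.
  rewrite /slice /shave /level -[in RHS]natr1 mulrDl mul1r -/(level k).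
  by rewrite /Num.min /Num.max; repeat case: ifPn; rewrite -?leNgt; lra.
have test_slice i : tests (U i) (fun x => N%:R * slice i x).
  split.
  - by apply: (@cM (cst N%:R)).
  - move=> x; apply/andP; split.
      by rewrite mulr_ge0// le_min shave_ge0 (ltW N0).
    by rewrite mulrC -ler_pdivlMr// mul1r ge_min lexx.
  - move=> x /negP; rewrite -leNgt => gx.
    by rewrite /slice /shave max_l ?subr_le0// min_r ?mulr0// ltW.
have Lslice i : ((L (slice i))%:E <= N%:R^-1%:E * mu (U i))%E.
  have -> : L (slice i) = N%:R^-1 * L (fun x => N%:R * slice i x).
    by rewrite LZ// mulrA mulVf ?pnatr_eq0// mul1r.
  rewrite EFinM lee_wpmul2l ?lee_fin ?(ltW N0)//.
  by rewrite muE//; exact: inner_ub.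
have gE : g = fun x => \sum_(i <- iota 0 N) slice i x.
  apply/funext => x; rewrite sum_slice /level mulfV ?pnatr_eq0// min_l//.
  by have /andP[] := g01 x.
pose ind i x : R := N%:R^-1 * \1_(U i) x.
have sum_ind k x : \sum_(i <- iota 0 k) ind i x <= g x + N%:R^-1 /\
    \sum_(i <- iota 0 k) ind i x <= level k.
  elim: k => [|k [IH1 IH2]].
    rewrite big_nil /level mul0r; split => //.
    by rewrite addr_ge0 ?(ltW N0)//; have /andP[] := g01 x.
  rewrite -addn1 iotaD add0n big_cat/= big_seq1.
  have lk : level (k + 1) = level k + N%:R^-1.
    by rewrite /level natrD mulrDl mul1r.
  rewrite lk /ind indicE; have [gk|gk] := ltP (level k) (g x).
    by rewrite mem_set// mulr1; split; lra.
  rewrite memNset; last by apply/negP; rewrite -leNgt.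
  by rewrite mulr0 addr0; split => //; rewrite (le_trans IH2)// lerDl ltW.
have mind i : measurable_fun [set: borel X] (fun x : borel X => (ind i x)%:E).
  apply/measurable_EFinP; apply: measurable_funM => //.
  by apply: measurable_indic; apply: sub_sigma_algebra; exact: oU.
have ind_ge0 i x : (0 <= (ind i x)%:E)%E.
  by rewrite lee_fin mulr_ge0// ltW.
rewrite -lee_fin {1}gE L_sum// -sumEFin.
apply: (@le_trans _ _ (\sum_(i <- iota 0 N) (N%:R^-1)%:E * mu (U i))%E).
  by apply: lee_sum => i _; exact: Lslice.
have cN : continuous (cst N%:R^-1 : X -> R^o) by exact: cc.
rewrite -[X in mean mu g + X](mean_cst mu) -meanD// meanE//; last exact: cD.
rewrite (eq_bigr (fun i => \int[mu]_(x in [set: borel X]) (ind i x)%:E)%E).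
  rewrite -ge0_integral_sum//; apply: le_lower_integral => x.
    by apply: sume_ge0 => i _.
  by rewrite sumEFin lee_fin; exact: (sum_ind N x).1.
move=> i _; rewrite /ind; under eq_integral do rewrite EFinM.
have mU : measurable (U i : set (borel X)) by apply: sub_sigma_algebra; exact: oU.
rewrite ge0_integralZl_EFin//.
- by rewrite integral_indic// setIT.
- by apply/measurable_EFinP; exact: measurable_indic.
Qed.

(** The Riesz representation theorem: [L_le_mean], applied to h and to 1 - h, gives
    equality for functions with values between 0 and 1, and linearity the rest. *)
Lemma riesz_representation : exists mu : borel_probability R X,
  forall g, continuous g -> mean mu g = L g.
Proof.
have [P PE] := probability_of_measure borel_outerT.
exists (to_borel P) => g cg; set mu := to_borel P.
have muE U : open U -> mu U = inner U.
  move=> oU; rewrite /mu to_borelE; last exact: sub_sigma_algebra.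
  by apply: eq_trans (PE U) _; exact: outer_open.
have L_eq h : continuous h -> (forall x, 0 <= h x <= 1) -> mean mu h = L h.
  move=> ch h01; apply/eqP; rewrite eq_le (L_le_mean muE)// andbT.
  (* The other inequality is the same one for 1 - h. *)
  have cNh : continuous (fun x => -1 * h x : R^o).
    exact: (@cM (cst (-1)) h (@cc (-1)) ch).
  have ch1 : continuous (fun x => 1 + -1 * h x : R^o).
    exact: (@cD (cst 1) _ (@cc 1) cNh).
  have /(L_le_mean muE ch1) : forall x, 0 <= 1 + -1 * h x <= 1.
    by move=> x; have := h01 x; lra.
  rewrite (LD (@cc 1) cNh) LZ// L_cst1 (meanD cX mu (@cc 1) cNh) (meanZ cX)//.
  by rewrite mean_cst; lra.
(* An affine change brings g between 0 and 1. *)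
have [K gK] := continuous_bounded cX cg.
pose C := `|K| + 1; have C0 : 0 < C by rewrite ltr_wpDl.
have cg1 : continuous (fun x => (2 * C)^-1 * g x : R^o).
  exact: (@cM (cst _) g (@cc _) cg).
have cg2 : continuous (fun x => 2^-1 + (2 * C)^-1 * g x : R^o).
  exact: (@cD (cst _) _ (@cc _) cg1).
have : mean mu (fun x => 2^-1 + (2 * C)^-1 * g x : R^o) =
    L (fun x => 2^-1 + (2 * C)^-1 * g x).
  apply: L_eq => // x; have : `|(2 * C)^-1 * g x| <= 2^-1.
    rewrite normrM gtr0_norm ?invr_gt0 ?mulr_gt0// ler_pdivrMl ?mulr_gt0//.
    rewrite mulrAC mulfV ?pnatr_eq0// mul1r (le_trans (gK x))//.
    by rewrite (le_trans (ler_norm K))// lerDl.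
  by rewrite ler_norml; lra.
rewrite (LD (@cc _) cg1) (meanD cX mu (@cc _) cg1) L_cst mean_cst LZ// (meanZ cX)//.
by move=> /addrI; apply: mulfI; rewrite invr_eq0 mulf_neq0// gt_eqF.
Qed.

End riesz.

(** * Measurability of the limit of empirical measures *)

Section cauchy_sequences.
Context (R : realType).

Lemma cvgn_cauchyP (u : nat -> R^o) : cvgn u <->
  forall e, 0 < e -> exists N, forall m, (N <= m)%N -> `|u m - u N| < e.
Proof.
split=> [/cvg_ex[l /cvgrPdist_lt ul] e e0|h].
  have e20 : 0 < e / 2 by rewrite divr_gt0.
  have [N _ hN] := ul _ e20; exists N => m Nm.
  rewrite (splitr e) (le_lt_trans (ler_distD l _ _))// ltrD//.
    by rewrite distrC; exact: hN.
  by apply: hN => /=.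
apply/cauchy_cvgP/cauchy_exP => e e0; have [N hN] := h e e0.
by exists (u N); exists N => // m /= Nm; rewrite /ball/= distrC; exact: hN.
Qed.

Lemma measurable_cvgn d (T : measurableType d) (u : nat -> T -> R^o) :
  (forall n, measurable_fun [set: T] (u n : T -> R)) ->
  measurable [set x | cvgn (u ^~ x)].
Proof.
move=> mu; rewrite (_ : [set _ | _] = \bigcap_j \bigcup_N \bigcap_m
    [set x | `|u (N + m)%N x - u N x| < j.+1%:R^-1]); last first.
  apply/seteqP; split=> x /=.
    move=> /cvgn_cauchyP h j _; have [|N hN] := h j.+1%:R^-1.
      by rewrite invr_gt0.
    by exists N => // m _; apply: hN; exact: leq_addr.
  move=> h; apply/cvgn_cauchyP => e e0; have [j je] := small_radius e0.
  have [N _ hN] := h j Logic.I; exists N => m Nm.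
  by apply: lt_trans je; rewrite -(subnKC Nm); exact: hN.
apply: bigcapT_measurable => j; apply: bigcupT_measurable => N.
apply: bigcapT_measurable => m.
have mf : measurable_fun setT (fun y => `|u (N + m)%N y - u N y| < j.+1%:R^-1).
  apply: measurable_fun_ltr => //.
  by apply: measurableT_comp => //; exact: measurable_funB.
rewrite -[X in measurable X]setTI.
exact: (mf measurableT [set true]).
Qed.

End cauchy_sequences.

Section empirical_limit.
Context (R : realType) (X : pmetricType R) (f : X -> X).
Hypothesis cX : compact [set: X].
Hypothesis cf : continuous f.
Local Notation M := (borel_probability R X).

Lemma mean_empirical (g : X -> R^o) x n : continuous g -> (forall x, 0 <= g x) ->
  mean (empirical R f x n) g =
  n.+1%:R^-1 * \sum_(i < n.+1) g (iter i f x).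
Proof.
move=> cg g0; apply: EFin_inj; rewrite meanE//.
have mg : measurable_fun [set: borel X] (fun x : borel X => (g x)%:E).
  by apply/measurable_EFinP; exact: continuous_measurable_borel.
have g0' (y : borel X) : [set: borel X] y -> (0 <= (g y)%:E)%E.
  by rewrite lee_fin.
rewrite (eq_measure_integral (orbit_average R f x n)); last first.
  by move=> A mA _; exact: to_borelE.
rewrite ge0_integral_mscale//.
rewrite ge0_integral_measure_sum//.
rewrite EFinM -sumEFin; congr (_ * _)%E; apply: eq_bigr => i _.
by rewrite integral_dirac// diracT mul1e.
Qed.

Lemma continuous_iter i : continuous (iter i f).
Proof.
elim: i => [|i IH] x; first exact: cvg_id.
by apply: continuous_comp; [exact: IH|exact: cf].
Qed.

Lemma measurable_mean_empirical (g : X -> R^o) n : continuous g ->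
  (forall x, 0 <= g x) ->
  measurable_fun [set: borel X]
    ((fun x => mean (empirical R f x n) g) : borel X -> R).
Proof.
move=> cg g0.
rewrite (_ : (fun x => _) =
    fun x => n.+1%:R^-1 * \sum_(i <- iota 0 n.+1) g (iter i f x)); last first.
  apply/funext => x; rewrite mean_empirical//.
  by rewrite -[iota 0 n.+1]/(index_iota 0 n.+1) big_mkord.
pose S (x : X) : R^o := \sum_(i <- iota 0 n.+1) g (iter i f x).
have cS : continuous S.
  apply: continuous_sum => i y.
  by apply: continuous_comp; [exact: continuous_iter|exact: cg].
have cnS : continuous (fun x => n.+1%:R^-1 * S x : R^o).
  move=> x; apply: (@continuousM _ _ (cst (n.+1%:R^-1)) S); last exact: cS.
  exact: cst_continuous.
exact: continuous_measurable_borel cnS.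
Qed.

Local Notation pou := (pou cX).
Local Notation net := (net cX).

(** Convergence of the integrals of the functions [pou n i] implies convergence of
    the integral of every continuous function; the limits form a positive functional,
    and the measure representing it is the weak limit. *)
Lemma cvg_measuresP (u : nat -> M) : cvgn u <->
  forall p : nat * nat, cvgn ((fun n => mean (u n) (pou p.1 p.2)) : nat -> R^o).
Proof.
split=> [/cvg_ex[mu /(cvg_meanP cX) umu] p|up].
  by apply/cvg_ex; exists (mean mu (pou p.1 p.2)); apply: umu; exact: pou_continuous.
have ug g : continuous g -> cvgn ((fun n => mean (u n) g) : nat -> R^o).
  move=> cg; apply/cvgn_cauchyP => e e0.
  have [n [eta eta0 hn]] := mean_near cX cg e0.
  have [N hN] : exists N, forall m, (N <= m)%N -> forall i, (i < size (net n))%N ->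
      `|mean (u m) (pou n i) - mean (u N) (pou n i)| < eta.
    have h k : exists N, forall m, (N <= m)%N -> forall i, (i < k)%N ->
        `|mean (u m) (pou n i) - lim (mean (u j) (pou n i) @[j --> \oo])| < eta / 2.
      elim: k => [|k [N hN]]; first by exists 0%N.
      have /cvgrPdist_lt/(_ (eta / 2)) := up (n, k).
      rewrite divr_gt0// => /(_ isT)[N' _ hN'].
      exists (maxn N N') => m; rewrite geq_max => /andP[Nm N'm] i.
      rewrite ltnS leq_eqVlt => /predU1P[->|ik]; last exact: hN.
      by rewrite distrC; exact: hN'.
    have [N hN] := h (size (net n)); exists N => m Nm i i_lt.
    rewrite (splitr eta).
    rewrite (le_lt_trans (ler_distD (lim (mean (u j) (pou n i) @[j --> \oo])) _ _))//.
    by rewrite ltrD ?hN// distrC hN.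
  by exists N => m Nm; apply: hn => i; exact: hN.
pose L (g : X -> R^o) : R := lim ((mean (u n) g : R^o) @[n --> \oo]).
have uL g : continuous g -> mean (u n) g @[n --> \oo] --> (L g : R^o) by move=> /ug.
have [| | | |mu muL] := @riesz_representation _ _ cX L.
- move=> g h cg ch; apply/cvg_lim => //; under eq_fun do rewrite (meanD cX)//.
  exact: cvgD (uL g cg) (uL h ch).
- move=> a g cg; apply/cvg_lim => //; under eq_fun do rewrite (meanZ cX)//.
  by apply: cvgM; [exact: cvg_cst|exact: uL].
- move=> g cg g0; apply: limr_ge; first exact: ug.
  by apply: nearW => n; exact: mean_ge0.
- by apply/cvg_lim => //; under eq_fun do rewrite mean_cst; exact: cvg_cst.
apply/cvg_ex; exists mu; apply/(cvg_meanP cX) => g cg.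
by rewrite muL//; exact: uL.
Qed.

(** The set of convergence is Borel because convergence is tested on countably many
    real sequences; on it the limit has measurable integrals, and off it the limit
    is a constant default. *)
Lemma measurable_empirical_limit :
  measurable_fun [set: borel X] (empirical_limit R f : borel X -> borel M).
Proof.
apply: (measurable_borel_measures (cX := cX)) => n i.
pose C := [set x : borel X | cvgn (empirical R f x)].
have mE k p : measurable_fun [set: borel X]
    ((fun x => mean (empirical R f x k) (pou p.1 p.2)) : borel X -> R).
  apply: measurable_mean_empirical; first exact: pou_continuous.
  exact: pou_ge0.
have mC : measurable C.
  rewrite (_ : C = \bigcap_j \bigcap_k [set x : borel X |
      cvgn (fun n => mean (empirical R f x n) (pou j k) : R^o)]); last first.
    apply/seteqP; split=> x /=.
      by move=> /cvg_measuresP h j _ k _; exact: (h (j, k)).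
    by move=> h; apply/cvg_measuresP => -[j k]; exact: (h j Logic.I k Logic.I).
  apply: bigcapT_measurable => j; apply: bigcapT_measurable => k.
  by apply: measurable_cvgn => m; exact: (mE m (j, k)).
rewrite -(setvU C); apply/measurable_funU => //; first exact: measurableC.
split.
  apply: (eq_measurable_fun (cst (mean (point : M) (pou n i)))).
    move=> x /[!inE] /= nCx; rewrite /empirical_limit.
    by rewrite dvgP.
  exact: measurable_cst.
apply: (@measurable_fun_cvg _ (borel X) R C
  (fun k x => mean (empirical R f x k) (pou n i))).
  by move=> k; apply: measurable_funS (mE k (n, i)).
move=> x Cx; have /(cvg_meanP cX) : empirical R f x k @[k --> \oo] -->
    empirical_limit R f x by exact: Cx.
by apply; exact: pou_continuous.
Qed.

End empirical_limit.

(** * The Levy-Prokhorov distance *)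

Section levy_prokhorov.
Context (R : realType) (X : pmetricType R).
Hypothesis cX : compact [set: X].
Local Notation M := (borel_probability R X).
Let dist (x y : X) : \bar R := (mdist x y)%:E.

Let open_neighborhood (e : R) (E : set X) : open (neighborhood dist e E).
Proof.
apply/open_mdistP => y [x Ex]; rewrite lte_fin => xy.
exists (e - mdist x y); first by rewrite subr_gt0.
move=> z yz; exists x => //; rewrite lte_fin.
by rewrite (le_lt_trans (metric_triangle _ y _))// addrC -ltrBrDr.
Qed.

Let measurable_neighborhood (e : R) (E : set X) :
  measurable (neighborhood dist e E : set (borel X)).
Proof. by apply: sub_sigma_algebra; exact: open_neighborhood. Qed.

(** The half of the defining condition that is assumed, applied to the points at
    distance at least e from E, gives the other half for E by complementation. *)
Let prokhorov_symmetric (mu nu : M) (e : R) :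
  (forall E : set (borel X), measurable E ->
    (nu E <= mu (neighborhood dist e E) + e%:E)%E) ->
  forall E : set (borel X), measurable E ->
    (mu E <= nu (neighborhood dist e E) + e%:E)%E.
Proof.
move=> h E mE; set V := neighborhood dist e E.
have mV : measurable (V : set (borel X)) by exact: measurable_neighborhood.
have := h _ (measurableC mV).
have : (mu (neighborhood dist e (~` V)) <= mu (~` E))%E.
  apply: le_measure; rewrite ?inE//; first exact: measurableC.
  move=> y [x Vx]; rewrite lte_fin => xy Ey; apply: Vx; exists y => //.
  by rewrite lte_fin metric_sym.
have fin (m : M) (A : set (borel X)) : measurable A -> m A \is a fin_num.
  by move=> mA; exact: fin_num_measure.
have eC (m : M) (A : set (borel X)) (mA : measurable A) :
    m (~` A) = (1 - m A)%E := probability_setC m mA.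
rewrite !eC// -(fineK (fin mu E mE)) -(fineK (fin nu V mV)).
have mW := measurable_neighborhood e (~` V).
rewrite -(fineK (fin mu _ mW)) -!EFinB -!EFinD !lee_fin; lra.
Qed.

(** A measure close to mu gives almost as much mass as mu to each of the finitely
    many unions of balls of a cover with small radius, and any set is squeezed
    between such a union and its own neighborhood. *)
Lemma open_levy_prokhorov_lt (nu : M) (t : R) :
  open [set mu : M | (levy_prokhorov dist mu nu < t%:E)%E].
Proof.
rewrite openE => mu /= /ereal_inf_lt[_ [e [e0 he] <-]]; rewrite lte_fin => et.
pose r := (t - e) / 3; have r0 : 0 < r by rewrite divr_gt0// subr_gt0.
have [s hs] := finite_net cX r0.
pose c (i : 'I_(size s)) := nth point s i.
pose U (b : {set 'I_(size s)}) := [set y | exists2 i, i \in b & mdist (c i) y < r].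
have oU b : open (U b).
  apply/open_mdistP => y [i ib iy]; exists (r - mdist (c i) y).
    by rewrite subr_gt0.
  move=> z yz; exists i => //.
  by rewrite (le_lt_trans (metric_triangle _ y _))// addrC -ltrBrDr.
have mU b : measurable (U b : set (borel X)) by exact: sub_sigma_algebra.
have near_mu : nbhs mu [set mu' : M | forall b, (mu (U b) - r%:E < mu' (U b))%E].
  apply: (@filter_forall M _ (fun b mu' => mu (U b) - r%:E < mu' (U b))%E
    _ (nbhs_filter mu)) => b.
  apply: open_nbhs_nbhs; split.
    by apply: open_measure_gt.
  rewrite /= -(fineK (fin_num_measure mu _ (mU b))) -EFinB lte_fin.
  by rewrite ltrBlDr ltrDl.
apply: filterS near_mu => mu' hmu'.
have h (E : set (borel X)) : measurable E ->
    (nu E <= mu' (neighborhood dist (e + 2 * r) E) + (e + 2 * r)%:E)%E.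
  move=> mE; set V := neighborhood dist e E.
  pose b : {set 'I_(size s)} :=
    [set i | `[< exists2 y, V y & mdist (c i) y < r >]]%SET.
  have VU : V `<=` U b.
    move=> y Vy; have [a sa ay] := hs y.
    have sa' : (index a s < size s)%N by rewrite index_mem.
    exists (Ordinal sa'); last by rewrite /c/= nth_index.
    by rewrite inE; apply/asboolP; exists y => //; rewrite /c/= nth_index.
  have UV : U b `<=` neighborhood dist (e + 2 * r) E.
    move=> y [i]; rewrite inE => /asboolP[z [x Ex]]; rewrite lte_fin => xz iz iy.
    exists x => //; rewrite lte_fin.
    have := metric_triangle x z y; have := metric_triangle z (c i) y.
    by rewrite [mdist z (c i)]metric_sym; lra.
  apply: (le_trans (he E mE).1).
  have mV := measurable_neighborhood e E.
  have mW := measurable_neighborhood (e + 2 * r) E.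
  have h1 : (mu V <= mu (U b))%E by apply: le_measure; rewrite ?inE.
  have h2 : (mu' (U b) <= mu' (neighborhood dist (e + 2 * r) E))%E.
    by apply: le_measure; rewrite ?inE.
  move: h1 h2 (hmu' b).
  have fin (m : M) (A : set (borel X)) : measurable A -> m A \is a fin_num.
    by move=> mA; exact: fin_num_measure.
  rewrite -(fineK (fin mu _ mV)) -(fineK (fin mu _ (mU b))).
  rewrite -(fineK (fin mu' _ (mU b))) -(fineK (fin mu' _ mW)).
  by rewrite -EFinB -!EFinD lte_fin !lee_fin; lra.
rewrite /= (@le_lt_trans _ _ (e + 2 * r)%:E)//; last first.
  by rewrite lte_fin /r; lra.
apply: ereal_inf_lbound; exists (e + 2 * r) => //; split.
  by rewrite addr_gt0// mulr_gt0.
by move=> E mE; split; [exact: h|exact: prokhorov_symmetric].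
Qed.

Lemma measurable_levy_prokhorov (nu : M) : measurable_fun [set: borel M]
  ((fun mu => levy_prokhorov dist mu nu) : borel M -> \bar R).
Proof.
apply: (measurability _ (ErealGenInftyO.measurableE R)).
move=> _ [_ [a ->] <-]; rewrite setTI; apply: sub_sigma_algebra.
rewrite (_ : _ @^-1` _ = [set mu : M | (levy_prokhorov dist mu nu < a%:E)%E]).
  exact: open_levy_prokhorov_lt.
by apply/seteqP; split=> mu /=; rewrite in_itv/=.
Qed.

End levy_prokhorov.

(** * The Wasserstein distances *)

(** Convexity of the power function makes it Lipschitz on bounded intervals: b is a
    convex combination of a and b + 1 with weight at most b - a on b + 1. *)
Lemma powR_lipschitz (R : realType) (p D a b : R) : 1 <= p ->
  0 <= a <= D -> 0 <= b <= D ->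
  `|a `^ p - b `^ p| <= (D + 1) `^ p * `|a - b|.
Proof.
move=> p1; have p0 : 0 <= p by rewrite (le_trans ler01).
wlog ab : a b / a <= b.
  move=> h aD bD; have [/h->//|/ltW ba] := leP a b.
  by rewrite distrC [`|a - b|]distrC h.
move=> /andP[a0 aD] /andP[b0 bD].
have ba0 : 0 <= b - a by rewrite subr_ge0.
have powab : a `^ p <= b `^ p by rewrite ge0_ler_powR.
rewrite distrC ger0_norm ?subr_ge0// [`|a - b|]distrC [in leRHS]ger0_norm//.
pose s := (b - a) / (b + 1 - a).
have den1 : 1 <= b + 1 - a by lra.
have s0 : 0 <= s by rewrite divr_ge0//; lra.
have sba : s <= b - a by rewrite ler_pdivrMr ?ler_peMr//; lra.
have s1 : s <= 1 by rewrite ler_pdivrMr; lra.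
have s'0 : 0 <= 1 - s by lra.
have s'1 : 1 - s <= 1 by lra.
have b1 : 0 <= b + 1 by lra.
have conv : ((1 - s) * a + (1 - (1 - s)) * (b + 1)) `^ p <=
    (1 - s) * a `^ p + (1 - (1 - s)) * (b + 1) `^ p.
  have := @convex_powR R p p1 (Itv01 s'0 s'1) a (b + 1).
  by rewrite !inE/= !in_itv/= !andbT => /(_ a0 b1).
rewrite subKr in conv.
have eb : (1 - s) * a + s * (b + 1) = b by rewrite /s; field; lra.
rewrite eb in conv.
have hD : (b + 1) `^ p <= (D + 1) `^ p by rewrite ge0_ler_powR ?nnegrE//; lra.
have hp : 0 <= a `^ p by exact: powR_ge0.
have hq : 0 <= (b + 1) `^ p by exact: powR_ge0.
rewrite lerBlDl (le_trans conv)// mulrBl mul1r.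
have h1 : s * (b + 1) `^ p <= (D + 1) `^ p * (b - a).
  by rewrite mulrC ler_pM.
have h2 : 0 <= s * a `^ p by rewrite mulr_ge0.
by lra.
Qed.

Section fibers.
Local Open Scope ereal_scope.
Context d (T : measurableType d) (R : realType) (I : finType) (idx : T -> I).
Variable m : {measure set T -> \bar R}.
Hypothesis midx : forall i, measurable [set z | idx z = i].

Lemma integral_fibers (a : I -> R) : (forall i, (0 <= a i)%R) ->
  \int[m]_z (a (idx z))%:E = \sum_i (a i)%:E * m [set z | idx z = i].
Proof.
move=> a0.
rewrite (eq_integral (fun z => \sum_i (a i * \1_[set z | idx z = i] z)%:E)).
  rewrite ge0_integral_sum//; last 2 first.
  - by move=> i; apply/measurable_EFinP; apply: measurable_funM.
  - by move=> i z _; rewrite lee_fin mulr_ge0.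
  apply: eq_bigr => i _; under eq_integral do rewrite EFinM.
  rewrite ge0_integralZl_EFin//; first by rewrite integral_indic// setIT.
  by apply/measurable_EFinP; exact: measurable_indic.
move=> z _; rewrite sumEFin (bigD1 (idx z))//= indicE mem_set// mulr1.
rewrite big1 ?addr0// => i iz; rewrite indicE memNset ?mulr0//.
by move=> /= zi; rewrite zi eqxx in iz.
Qed.

End fibers.

Lemma measure_fibers d (T : measurableType d) (R : realType) (I : finType)
    (idx : T -> I) (m : {measure set T -> \bar R}) (A : set T) :
  (forall i, measurable [set z | idx z = i]) -> measurable A ->
  (m A = \sum_i m (A `&` [set z | idx z = i]))%E.
Proof.
move=> midx mA.
have := integral_fibers (mrestr m mA) midx (fun=> ler01).
rewrite integral_cst// mul1e => h.
have -> : m A = mrestr m mA setT by rewrite /mrestr setTI.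
by apply: (eq_trans h); apply: eq_bigr => i _; rewrite mul1e /= /mrestr setIC.
Qed.

Section disintegration.
Local Open Scope ereal_scope.
Context (R : realType).

(** When the total mass s vanishes, the equation holds for any probability k, so that
    empty cells need no separate treatment. *)
Lemma scaled_probability d (T : measurableType d) (m : {measure set T -> \bar R})
    (s : R) (nu : probability T R) : m setT = s%:E ->
  exists k : probability T R, forall B, measurable B -> s%:E * k B = m B.
Proof.
move=> ms; exists (mnormalize m nu) => B mB; rewrite /= /mnormalize ms.
case: ifPn => [/orP[/eqP s0|/eqP//]|].
  rewrite s0 mul0e; apply/esym/eqP; rewrite eq_le measure_ge0 andbT.
  by rewrite -s0 -ms; apply: le_measure; rewrite ?inE.
rewrite negb_or eqe => /andP[s0 _] /=.
by rewrite muleCA -EFinM mulfV// mule1.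
Qed.

Lemma measure_pushforward d d' (T : measurableType d) (U : measurableType d')
    (mu : {measure set T -> \bar R}) (phi : T -> U) :
  measurable_fun [set: T] phi ->
  exists m : {measure set U -> \bar R}, forall A, m A = mu (phi @^-1` A).
Proof.
move=> mphi; pose m : {measure set U -> \bar R} := pushforward mu phi.
by exists (m mphi).
Qed.

Lemma section_measure d d' (T : measurableType d) (U : measurableType d')
    (pi : {measure set (T * U)%type -> \bar R}) (C : set T) : measurable C ->
  exists m : {measure set U -> \bar R}, forall B, m B = pi (C `*` B).
Proof.
move=> mC; have mCT : measurable (C `*` [set: U]) by exact: measurableX.
have [m mE] := measure_pushforward (mrestr pi mCT) (@measurable_snd _ _ T U).
exists m => B; rewrite mE /mrestr; congr (pi _).
by apply/seteqP; split => [[x y] /= [By [Cx _]]|[x y] /= [Cx By]].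
Qed.

End disintegration.

Section cells.
Context (R : realType) (X : pmetricType R).
Hypothesis cX : compact [set: X].
Local Notation M := (borel_probability R X).
Local Notation net := (net cX).
Local Notation center := (center cX).
Implicit Types mu nu : M.

(** Taking the first close point of the net makes each cell a difference of two
    open sets, so that its mass depends measurably on the measure. *)
Definition cell_number n (x : X) : nat :=
  find (fun c => mdist c x < n.+1%:R^-1) (net n).

Lemma cell_number_lt n x : (cell_number n x < size (net n))%N.
Proof.
rewrite -has_find; have [i i_lt ix] := netP cX n x.
by apply/hasP; exists (center n i) => //; exact: mem_nth.
Qed.

Lemma cell_number_close n x :
  mdist (center n (cell_number n x)) x < n.+1%:R^-1.
Proof.
have := cell_number_lt n x; rewrite -has_find => h.
exact: (nth_find point h).
Qed.

Definition cell n i : set X := [set x | cell_number n x = i].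

Let open_cells n k : open [set x | (cell_number n x < k)%N].
Proof.
apply/open_mdistP => x xk; set i := cell_number n x.
exists (n.+1%:R^-1 - mdist (center n i) x).
  by rewrite subr_gt0; exact: cell_number_close.
move=> y xy /=; apply: leq_ltn_trans xk; rewrite leqNgt; apply/negP => iy.
have /negP := before_find point iy; apply.
by rewrite -/(center n i) (le_lt_trans (metric_triangle _ x _))// addrC -ltrBrDr.
Qed.

Let measurable_cells n k :
  measurable ([set x | (cell_number n x < k)%N] : set (borel X)).
Proof. by apply: sub_sigma_algebra; exact: open_cells. Qed.

Let cellE n i : cell n i =
  [set x | (cell_number n x < i.+1)%N] `\` [set x | (cell_number n x < i)%N].
Proof.
apply/seteqP; split => x /=; rewrite /cell/=; first by move=> ->; rewrite ltnn.
by move=> [h /negP]; rewrite -leqNgt => h'; apply/eqP; rewrite eqn_leq h' andbT.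
Qed.

Lemma measurable_cell n i : measurable (cell n i : set (borel X)).
Proof. by rewrite cellE; exact: measurableD. Qed.

Lemma measurable_cell_mass n i : measurable_fun [set: borel M]
  ((fun mu => fine (mu (cell n i))) : borel M -> R).
Proof.
apply: measurableT_comp => //.
rewrite (_ : (fun mu => _) = fun mu : M =>
  (mu [set x | (cell_number n x < i.+1)%N] -
   mu [set x | (cell_number n x < i)%N])%E).
  by apply: emeasurable_funB; exact: measurable_measure_open.
apply/funext => mu; rewrite cellE; apply: eq_trans (measureD _ _ _) _ => //.
  by apply: (le_lt_trans (probability_le1 mu _)); rewrite ?ltry.
congr (_ - mu _)%E; apply/setIidPr => x /= h; exact: (ltn_trans h).
Qed.

Local Notation N n := (size (net n)).

Definition cell_index n (x : X) : 'I_(N n) := Ordinal (cell_number_lt n x).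

Lemma cell_indexE n (i : 'I_(N n)) : [set x | cell_index n x = i] = cell n i.
Proof.
apply/seteqP; split => x /=; first by move=> <-.
by move=> h; apply: val_inj.
Qed.

(** Inside each cell, an amount of mu' equal to lam times the mass under mu is sent
    where the given plan sends that cell, in the same proportions, and the rest of
    mu' is spread over the space in proportion to nu.  This couples mu' and nu with
    products of measures only. *)
Lemma transfer_plan n mu mu' nu (pi : probability (borel X * borel X)%type R)
    (lam : R) : transport_plan mu nu pi -> 0 <= lam ->
  (forall i, lam * fine (mu (cell n i)) <= fine (mu' (cell n i))) ->
  exists2 pi', transport_plan mu' nu pi' &
    forall i B, measurable (B : set (borel X)) -> (i < N n)%N ->
      pi' (cell n i `*` B) = (lam%:E * pi (cell n i `*` B) +
        (fine (mu' (cell n i)) - lam * fine (mu (cell n i)))%:E * nu B)%E.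
Proof.
move=> piP lam0 le_mass.
pose w i := fine (mu' (cell n i)) - lam * fine (mu (cell n i)).
have w0 i : 0 <= w i by rewrite subr_ge0.
have fin (m : M) (A : set (borel X)) : measurable A -> (fine (m A))%:E = m A.
  by move=> mA; rewrite fineK//; exact: fin_num_measure.
have mc i := measurable_cell n i.
have /choice[k kE] i : exists k : probability (borel X) R,
    forall B, measurable B -> ((fine (mu' (cell n i)))%:E * k B =
      lam%:E * pi (cell n i `*` B) + (w i)%:E * nu B)%E.
  have [m mE] := section_measure pi (mc i).
  pose m2 : {measure set (borel X) -> \bar R} :=
    measure_add (mscale (NngNum lam0) m) (mscale (NngNum (w0 i)) nu).
  have m2E B : m2 B = (lam%:E * pi (cell n i `*` B) + (w i)%:E * nu B)%E.
    by apply: eq_trans (measure_addE _ _ B) _; rewrite /= /mscale/= mE.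
  have [|k kE] := @scaled_probability _ _ _ m2 (fine (mu' (cell n i))) nu.
    rewrite m2E (piP _ (mc i)).1 probability_setT mule1.
    by rewrite -fin// -EFinM -EFinD /w addrC subrK.
  by exists k => B mB; rewrite kE// m2E.
pose m3 : {measure set (borel X * borel X)%type -> \bar R} :=
  msum (fun i => (mrestr mu' (mc i) \x k i)%E) (N n).
have m3E A B : measurable (A : set (borel X)) -> measurable (B : set (borel X)) ->
    m3 (A `*` B) = (\sum_(i < N n) mu' (A `&` cell n i) * k i B)%E.
  by move=> mA mB; apply: eq_bigr => i _; rewrite /= product_measure1E.
have mfib (i : 'I_(N n)) : measurable ([set x | cell_index n x = i] : set (borel X)).
  by rewrite cell_indexE.
have m3l A : measurable (A : set (borel X)) -> m3 (A `*` setT) = mu' A.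
  move=> mA; rewrite m3E// (measure_fibers mu' mfib mA).
  apply: eq_bigr => i _; rewrite cell_indexE.
  by rewrite [X in (_ * X)%E](probability_setT (k i)) mule1.
have [|pi' pi'E] := @probability_of_measure _ _ _ m3.
  by rewrite -setXTT m3l// probability_setT.
have sum_mass (m : M) : \sum_(i < N n) fine (m (cell n i)) = 1.
  apply: EFin_inj; rewrite -sumEFin -[RHS](probability_setT m).
  rewrite (measure_fibers m mfib measurableT).
  by apply: eq_bigr => i _; rewrite fin// cell_indexE setTI.
exists pi'.
  move=> A mA; rewrite !pi'E; split; first exact: m3l.
  have mX (i : 'I_(N n)) :
      measurable ([set z | cell_index n z.1 = i] : set (borel X * borel X)).
    rewrite (_ : [set _ | _] = cell n i `*` setT); first exact: measurableX.
    rewrite -cell_indexE; apply/seteqP; by split => z //= [].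
  have sum_pi : \sum_(i < N n) fine (pi (cell n i `*` A)) = fine (nu A).
    apply: EFin_inj; rewrite -sumEFin fin// -(piP A mA).2.
    have mTA : measurable ([set: X] `*` A : set (borel X * borel X)).
      exact: measurableX.
    rewrite (measure_fibers pi mX mTA); apply: eq_bigr => i _.
    rewrite fineK; last by apply: fin_num_measure; exact: measurableX.
    congr (pi _); rewrite -cell_indexE.
    by apply/seteqP; split => z /= [] // [].
  have m3r : m3 (setT `*` A) =
      (\sum_(i < N n) (lam * fine (pi (cell n i `*` A)) + w i * fine (nu A))%:E)%E.
    rewrite m3E//; apply: eq_bigr => i _; rewrite setTI -(fin mu')// kE//.
    rewrite -[in LHS](fin nu)// -[pi _]fineK; last first.
      by apply: fin_num_measure; exact: measurableX.
    by rewrite -!EFinM -EFinD.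
  rewrite m3r sumEFin big_split/= -mulr_sumr -mulr_suml sum_pi /w sumrB -mulr_sumr.
  by rewrite !sum_mass mulr1 -mulrDl addrC subrK mul1r fin.
move=> i B mB i_lt; rewrite pi'E m3E// (bigD1 (Ordinal i_lt))//= setIid.
rewrite -(fin mu')// kE// big1 ?adde0// => j ji.
rewrite (_ : cell n i `&` cell n j = set0) ?measure0 ?mul0e//.
rewrite -subset0 => x [/= xi xj]; case/eqP: ji; apply: val_inj => /=.
by rewrite -xi -xj.
Qed.

(** The cost is nearly constant on products of cells, so that the cost of a plan is
    determined, up to a small error, by the masses that it gives to them. *)
Lemma wasserstein_lt_cells (p t : R) mu nu : 1 <= p ->
  (wasserstein (fun x y : X => (mdist x y)%:E) p mu nu < t%:E)%E ->
  exists n, exists2 eta, 0 < eta & forall mu',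
    (forall i, (i < N n)%N ->
      `|fine (mu' (cell n i)) - fine (mu (cell n i))| < eta) ->
    (wasserstein (fun x y : X => (mdist x y)%:E) p mu' nu < t%:E)%E.
Proof.
move=> p1; have p0 : 0 < p by rewrite (lt_le_trans ltr01).
move=> /ereal_inf_lt[_ [pi piP <-]].
pose cost (z : borel X * borel X) : R := mdist z.1 z.2 `^ p.
have cost_ge0 z : 0 <= cost z by exact: powR_ge0.
have costE (q : probability (borel X * borel X)%type R) :
    (\int[q]_z ((mdist z.1 z.2)%:E `^ p) = \int[q]_z (cost z)%:E)%E.
  by apply: eq_integral => z _; rewrite poweR_EFin.
have int_ge0 (q : probability (borel X * borel X)%type R) :
    (0 <= \int[q]_z (cost z)%:E)%E.
  by apply: integral_ge0 => z _; rewrite lee_fin.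
have root_lt (J : \bar R) : (0 <= J)%E -> 0 < t ->
    (J `^ p^-1 < t%:E)%E = (J < (t `^ p)%:E)%E.
  move=> J0 t0; apply/idP/idP; apply: contraTT; rewrite -!leNgt => h.
    have tE : (t%:E = (t `^ p)%:E `^ p^-1)%E.
      rewrite -poweR_EFin -poweRrM mulfV ?gt_eqF// poweRe1// lee_fin; exact: ltW.
    rewrite tE; apply: gt0_ler_poweR h; rewrite ?in_itv/= ?leey ?andbT//.
      by rewrite invr_ge0 ltW.
    by rewrite lee_fin powR_ge0.
  have JE : (J = (J `^ p^-1) `^ p)%E.
    by rewrite -poweRrM mulVf ?gt_eqF// poweRe1.
  rewrite JE -poweR_EFin; apply: gt0_ler_poweR h; rewrite ?in_itv/= ?leey ?andbT.
  - exact: ltW.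
  - by rewrite lee_fin ltW.
  - exact: poweR_ge0.
rewrite costE => pi_lt.
have t0 : 0 < t by rewrite -lte_fin (le_lt_trans _ pi_lt)// poweR_ge0.
move: pi_lt; rewrite root_lt// => pi_lt.
have [D hD] : exists D, forall x y : X, mdist x y <= D.
  have [K hK] := continuous_bounded cX (@mdist_continuous R X point).
  exists (K + K) => x y; rewrite (le_trans (metric_triangle _ point _))//.
  by rewrite metric_sym lerD// (le_trans (ler_norm _))// hK.
have hD0 (x y : X) : 0 <= mdist x y <= D.
  by apply/andP; split; [exact: mdist_ge0|exact: hD].
have D0 : 0 <= D by rewrite (le_trans (mdist_ge0 (point : X) point)).
pose L := (D + 1) `^ p.
have L0 : 0 < L by rewrite powR_gt0// ltr_wpDl.
have fin_int : (\int[pi]_z (cost z)%:E)%E \is a fin_num.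
  by rewrite ge0_fin_numE// (lt_trans pi_lt)// ltry.
pose gap := t `^ p - fine (\int[pi]_z (cost z)%:E)%E.
have gap0 : 0 < gap by rewrite subr_gt0 -lte_fin fineK.
pose om := gap / 8; have om0 : 0 < om by rewrite divr_gt0.
have [n hn] : exists n, n.+1%:R^-1 < om / (2 * L).
  by apply: small_radius; rewrite divr_gt0// mulr_gt0.
(* Rerouting the fraction s costs at most s * L <= gap / 4, and discretizing the
   cost of both plans at most 2 * om = gap / 4. *)
pose s := Num.min 2^-1 (gap / (4 * L)).
have s0 : 0 < s by rewrite lt_min invr_gt0 ltr0n/= divr_gt0// mulr_gt0.
have s1 : s <= 2^-1 by rewrite ge_min lexx.
have sL : s * L <= gap / 4.
  rewrite -ler_pdivlMr// ge_min; apply/orP; right.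
  by rewrite invfM mulrA.
pose lam := 1 - s.
pose eta := \big[Num.min/1]_(i < N n)
  (if 0 < fine (mu (cell n i)) then s * fine (mu (cell n i)) else 1).
have eta0 : 0 < eta.
  apply: lt_bigmin => // i _; case: ifPn => // h; exact: mulr_gt0.
exists n, eta => // mu' mu'P.
have fin (m : M) (A : set (borel X)) : measurable A -> (fine (m A))%:E = m A.
  by move=> mA; rewrite fineK//; exact: fin_num_measure.
have mc i := measurable_cell n i.
have lam0 : 0 <= lam by rewrite /lam; lra.
have le_mass i : lam * fine (mu (cell n i)) <= fine (mu' (cell n i)).
  have mu'0 : 0 <= fine (mu' (cell n i)) by rewrite fine_ge0.
  have [i_lt|i_ge] := ltnP i (N n); last first.
    have -> : cell n i = set0.
      rewrite -subset0 => x /= xi; have := cell_number_lt n x.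
      by rewrite xi ltnNge i_ge.
    by rewrite !measure0 mulr0.
  have := mu'P i i_lt; rewrite ltr_distl => /andP[h _].
  have [mui|mui] := ltP 0 (fine (mu (cell n i))); last first.
    by rewrite (le_trans _ mu'0)// mulr_ge0_le0.
  have : eta <= s * fine (mu (cell n i)).
    by rewrite /eta (le_trans (bigmin_le _ (Ordinal i_lt) _))//= mui.
  by rewrite /lam mulrBl mul1r; lra.
have [pi' pi'P pi'E] := transfer_plan piP lam0 le_mass.
apply: (@le_lt_trans _ _ ((\int[pi']_z (cost z)%:E) `^ p^-1)%E).
  by rewrite -costE; apply: ereal_inf_lbound; exists pi'.
rewrite root_lt//.
pose I := ('I_(N n) * 'I_(N n))%type.
pose idx (z : borel X * borel X) : I := (cell_index n z.1, cell_index n z.2).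
have fibE (q : I) : [set z | idx z = q] = cell n q.1 `*` cell n q.2.
  case: q => i j; rewrite -!cell_indexE; apply/seteqP; split=> -[x y] /=.
    by move=> h; split; [exact: (congr1 fst h)|exact: (congr1 snd h)].
  by move=> [xi yj]; rewrite /idx/= xi yj.
have midx (q : I) : measurable [set z | idx z = q].
  by rewrite fibE; exact: measurableX.
pose a (q : I) := mdist (center n q.1) (center n q.2) `^ p.
have a_le q : a q <= L.
  by rewrite ge0_ler_powR ?nnegrE ?mdist_ge0 ?(ltW p0)// ?ler_wpDr// addr_ge0.
have osc z : `|cost z - a (idx z)| <= om.
  rewrite (le_trans (powR_lipschitz p1 (hD0 _ _) (hD0 _ _)))// -/L.
  rewrite -ler_pdivlMl//.
  pose c1 := center n (cell_number n z.1); pose c2 := center n (cell_number n z.2).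
  rewrite -/(idx z) -[center n (idx z).1]/c1 -[center n (idx z).2]/c2.
  have h1 : mdist c1 z.1 < om / (2 * L) := lt_trans (cell_number_close n z.1) hn.
  have h2 : mdist c2 z.2 < om / (2 * L) := lt_trans (cell_number_close n z.2) hn.
  have -> : L^-1 * om = om / (2 * L) + om / (2 * L) by field; rewrite gt_eqF.
  have := metric_triangle z.1 c1 z.2; have := metric_triangle c1 c2 z.2.
  have := metric_triangle c1 z.1 c2; have := metric_triangle z.1 z.2 c2.
  rewrite [mdist z.1 c1]metric_sym [mdist z.2 c2]metric_sym.
  move: h1 h2; set u := om / (2 * L); clear; move=> *.
  by rewrite ler_norml; apply/andP; split; lra.
pose b (q : I) := Num.max 0 (a q - om).
have b0 q : 0 <= b q by rewrite le_max lexx.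
pose P (q : I) := fine (pi (cell n q.1 `*` cell n q.2)).
pose P' (q : I) := fine (pi' (cell n q.1 `*` cell n q.2)).
pose V (q : I) :=
  (fine (mu' (cell n q.1)) - lam * fine (mu (cell n q.1))) * fine (nu (cell n q.2)).
have V0 q : 0 <= V q.
  by rewrite mulr_ge0 ?subr_ge0 ?fine_ge0.
have P'E q : P' q = lam * P q + V q.
  apply: EFin_inj; rewrite /P' fineK; last first.
    by apply: fin_num_measure; exact: measurableX.
  have piF : pi (cell n q.1 `*` cell n q.2) = (P q)%:E.
    by rewrite fineK//; apply: fin_num_measure; exact: measurableX.
  by rewrite pi'E// piF -(fin nu)// -!EFinM -EFinD.
have sumP (q : probability (borel X * borel X)%type R) :
    \sum_(i : I) fine (q (cell n i.1 `*` cell n i.2)) = 1.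
  apply: EFin_inj; rewrite -sumEFin -[RHS](probability_setT q).
  rewrite (measure_fibers q midx measurableT); apply: eq_bigr => i _.
  rewrite fibE setTI fineK//.
  by apply: fin_num_measure; exact: measurableX.
have int_step (q : probability (borel X * borel X)%type R) (c : I -> R) :
    (forall i, 0 <= c i) -> (\int[q]_z (c (idx z))%:E =
    (\sum_(i : I) c i * fine (q (cell n i.1 `*` cell n i.2)))%:E)%E.
  move=> c0; rewrite (integral_fibers q midx c0) -sumEFin; apply: eq_bigr => i _.
  rewrite EFinM fibE fineK//.
  by apply: fin_num_measure; exact: measurableX.
have lower : \sum_(i : I) b i * P i <= fine (\int[pi]_z (cost z)%:E)%E.
  rewrite -lee_fin -int_step// fineK//; apply: le_lower_integral => z.
    by rewrite lee_fin.
  rewrite lee_fin ge_max cost_ge0/= lerBlDr.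
  by have := osc z; rewrite ler_norml => /andP[]; clear; move=> *; lra.
have upper : (\int[pi']_z (cost z)%:E <=
    (\sum_(i : I) (b i + om *+ 2) * P' i)%:E)%E.
  rewrite -int_step; last by move=> i; rewrite addr_ge0// mulrn_wge0// ltW.
  apply: le_lower_integral => z; first by rewrite lee_fin.
  rewrite lee_fin; have := osc z; rewrite ler_norml => /andP[_ h].
  have : a (idx z) - om <= b (idx z) by rewrite le_max lexx orbT.
  by move: h; clear; move=> *; lra.
apply: (le_lt_trans upper); rewrite lte_fin.
have sumV : \sum_(i : I) V i = s.
  have : \sum_(i : I) P' i = lam * \sum_(i : I) P i + \sum_(i : I) V i.
    by rewrite mulr_sumr -big_split; apply: eq_bigr => i _; exact: P'E.
  by rewrite !sumP mulr1 => h; apply: (addrI lam); rewrite -h subrK.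
have -> : \sum_(i : I) (b i + om *+ 2) * P' i =
    lam * \sum_(i : I) b i * P i + \sum_(i : I) b i * V i + om *+ 2.
  rewrite -[om *+ 2 in RHS]mulr1 -(sumP pi') !mulr_sumr -!big_split/=.
  by apply: eq_bigr => i _; rewrite -/(P' i) P'E; ring.
have bV : \sum_(i : I) b i * V i <= s * L.
  rewrite -sumV mulr_suml; apply: ler_sum => i _; rewrite mulrC.
  by rewrite ler_wpM2l// ge_max (ltW L0)/= (le_trans _ (a_le i))// gerBl ltW.
have bP : lam * \sum_(i : I) b i * P i <= \sum_(i : I) b i * P i.
  rewrite ler_piMl//; last by rewrite gerBl ltW.
  by apply: sumr_ge0 => i _; rewrite mulr_ge0// fine_ge0.
have gapE : fine (\int[pi]_z (cost z)%:E)%E = t `^ p - gap by rewrite /gap subKr.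
by move: lower bP bV sL gap0; rewrite gapE /om; clear; move=> *; lra.
Qed.

Lemma measurable_wasserstein (p : R) nu : 1 <= p ->
  measurable_fun [set: borel M]
    ((fun mu => wasserstein (fun x y : X => (mdist x y)%:E) p mu nu)
      : borel M -> \bar R).
Proof.
move=> p1; apply: (measurability _ (ErealGenInftyO.measurableE R)).
move=> _ [_ [t ->] <-]; rewrite setTI.
apply: (measurable_separated (h := fun (q : nat * nat) (mu : borel M) =>
  fine (mu (cell q.1 q.2)))) => [q|mu /=]; first exact: measurable_cell_mass.
rewrite in_itv/= => /(wasserstein_lt_cells p1)[n [eta eta0 h]].
exists [seq (n, i) | i <- iota 0 (N n)], eta => // mu' mu'P /=.
rewrite in_itv/=; apply: h => i i_lt; apply: (mu'P (n, i)).
by apply/mapP; exists i => //; rewrite mem_iota.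
Qed.

End cells.

(** * Emergence is quantization *)

Section distance.
Local Open Scope ereal_scope.
Context (R : realType).

Lemma distance_of_ge0 (D : measure_distance R) (Y : ptopologicalType)
    (dist : Y -> Y -> \bar R) (mu nu : borel_probability R Y) :
  0 <= distance_of D dist mu nu.
Proof.
case: D => [p p1|]; apply: le_ereal_inf_tmp => x [].
  by move=> pi _ <-; exact: poweR_ge0.
by move=> e [e0 _] <-; rewrite lee_fin ltW.
Qed.

Lemma measurable_distance_of (X : pmetricType R) (D : measure_distance R)
    (nu : borel_probability R X) : compact [set: X] ->
  measurable_fun [set: borel (borel_probability R X)]
    ((fun mu => distance_of D (fun x y : X => (mdist x y)%:E) mu nu)
      : borel (borel_probability R X) -> \bar R).
Proof.
move=> cX; case: D => [p p1|]; first exact: measurable_wasserstein.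
exact: measurable_levy_prokhorov.
Qed.

End distance.

Theorem proposition3p12 (R : realType) (X : pmetricType R) (f : X -> X)
    (D : measure_distance R) (mu : borel_probability R X) (eps : R) :
  compact [set: X] -> continuous f -> invariant_measure f mu -> 0 < eps ->
  let d := distance_of D (fun x y : X => (mdist x y)%:E) in
  metric_emergence f d mu eps =
  quantization_number (wasserstein d 1) (ergodic_decomposition f mu) eps.
Proof.
move=> cX cf _ _ d.
have d0 nu nu' : (0 <= d nu nu')%E by exact: distance_of_ge0.
have md nu := measurable_distance_of D nu cX.
have me := measurable_empirical_limit cX cf.
have mpt := measurable_singleton cX.
apply/eqP; rewrite eq_le; apply/andP; split; apply: le_ereal_inf_tmp => x [n].
  move=> [nuhat [W_le [S [Sn S1]]]] <-; apply: ereal_inf_lbound; exists n => //.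
  exact: (centers_of_quantization d0 md me W_le Sn S1).
move=> [nu cost_le] <-.
have [k kn qk] := quantization_of_centers d0 md mpt me cost_le.
by apply: ge_ereal_inf; exists k%:R%:E; [exists k|rewrite lee_fin ler_nat].
Qed.
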